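(* Let $0\le i\le k$, $0\le r\le d$ be integers. Let $\mathcal{C}$ be an $i$-dimensional simplicial complex contained in the coordinate subspace $\{x_{i+1}=\cdots=x_k=0\}\subseteq\mathbb{R}^k$ which is the star of the origin $O$ (every maximal simplex contains $O$, and $O$ is its only interior vertex), let $\tau$ be a $(k-i)$-simplex with vertices $v_0=O,v_1,\dots,v_{k-i}$ lying in $\{x_1=\cdots=x_i=0\}$, and let $\mathcal{O}'$ be the simplicial complex whose maximal simplices are $\omega*v_1*\cdots*v_{k-i}$ for the maximal simplices $\omega$ of $\mathcal{C}$ (together with all their faces). For $0\le j\le d$ let $\mathcal{C}_j=(j/d)\,\mathcal{C}$ (with $\mathcal{C}_0=\{O\}$), and let $\mathcal{M}_j$ be a minimal determining set for $S^r_j(\mathcal{C}_j)$ (for $j=0$ this is the single point $O$). Then a minimal determining set for $S^r_d(\mathcal{O}')$ is \[ \mathcal{M}'=\bigcup_{j=0}^{d}\bigl\{\,p+\xi^\tau_{j,j_1,\dots,j_{k-i}}\colon p\in\mathcal{M}_j,\ \xi^\tau_{j,j_1,\dots,j_{k-i}}\in\mathcal{D}^\tau\bigr\}. \] Moreover, \[ \dim S^r_d(\mathcal{O}')=\sum_{j=0}^{d}\binom{d+k-j-i-1}{k-i-1}\,|\mathcal{M}_j|. \]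
   Context: For a simplicial complex $\Delta$, $S^r_d(\Delta)$ is the space of $C^r$-smooth functions on the union of its simplices that are polynomials of degree at most $d$ on each maximal simplex. Bernstein–Bézier form: for an $m$-simplex with vertices $w_0,\dots,w_m$, the degree-$d$ domain points are $\sum_s \ell_s w_s/d$ with nonnegative integers $\sum_s\ell_s=d$; each polynomial of degree $\le d$ on the simplex is uniquely a linear combination of the degree-$d$ Bernstein basis polynomials, whose coefficients are indexed by these domain points. A spline in $S^0_d(\Delta)$ is thus identified with an assignment of coefficients to the set $\mathcal{D}$ of all degree-$d$ domain points of simplices of $\Delta$ (coefficients at shared points coincide). A subset $\mathcal{M}\subseteq\mathcal{D}$ is a determining set for a subspace $S\subseteq S^0_d(\Delta)$ if every $s\in S$ whose coefficients at all points of $\mathcal{M}$ vanish is identically zero; a minimal determining set is one of smallest cardinality (its cardinality equals $\dim S$). Here $\mathcal{D}^\tau=\{\xi^\tau_{j,j_1,\dots,j_{k-i}}=(j_1v_1+\cdots+j_{k-i}v_{k-i})/d\colon j+j_1+\cdots+j_{k-i}=d,\ j,j_s\ge0\}$ denotes the degree-$d$ domain points of $\tau$, with first index $j$ attached to $v_0=O$. Binomial coefficients with lower index $-1$ (case $i=k$) follow the convention $\binom{-1}{-1}=1$, $\binom{m}{-1}=0$ for $m\ge0$. *)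

(* Defs.v *)
From HB Require Import structures.
From mathcomp Require Import all_boot all_order all_algebra finmap.
From mathcomp Require Import all_classical all_reals all_analysis.
From mathcomp Require Import -(notations) mpoly.

Set Implicit Arguments.
Unset Strict Implicit.
Unset Printing Implicit Defensive.

Import Order.TTheory GRing.Theory Num.Theory.
Import numFieldNormedType.Exports.

Local Open Scope classical_set_scope.
Local Open Scope ring_scope.

Section families.
Context {R : realType} {k : nat} {I : finType}.
Implicit Types (v : I -> 'rV[R]_k) (b : I -> R).

Definition affinely_independent v :=
  forall b, \sum_t b t = 0 -> \sum_t b t *: v t = 0 -> forall t, b t = 0.

Definition is_weight b := (forall t, 0 <= b t) /\ \sum_t b t = 1.

(* The empty family has no weights, so its hull is empty. *)
Definition conv_hull v : set 'rV[R]_k :=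
  [set x | exists2 b, is_weight b & x = \sum_t b t *: v t].

(* Multi-indices of total degree d, each entry being at most d. *)
Definition multi_index (d : nat) : pred {ffun I -> 'I_d.+1} :=
  fun l => (\sum_t l t)%N == d.

(* In degree 0 the convention x / 0 = 0 makes the origin the only domain
   point, in accordance with the scaled complex C_0 = {O} below. *)
Definition domain_point d v (l : {ffun I -> 'I_d.+1}) : 'rV[R]_k :=
  d%:R^-1 *: \sum_t (l t)%:R *: v t.

(* Bernstein polynomial, as a function of the barycentric coordinates. *)
Definition bernstein d (l : {ffun I -> 'I_d.+1}) b : R :=
  (d`!)%:R / (\prod_t (l t)`!)%:R * \prod_t b t ^+ l t.

End families.
Arguments multi_index I d : clear implicits.

Section complexes.
Context {R : realType} {k : nat}.
Local Notation E := 'rV[R]_k.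
(* A simplex is encoded by its set of vertices. *)
Implicit Types (s : {fset E}) (K : set {fset E}).

Definition vertices s : s -> E := fun w => val w.

Record simplicial_complex K : Prop := SimplicialComplex {
  complex_finite : finite_set K;
  complex_nonempty : forall s, K s -> s != fset0;
  complex_affine : forall s, K s -> affinely_independent (@vertices s);
  complex_face : forall s s', K s -> s' != fset0 -> (s' `<=` s)%fset -> K s';
  complex_cap : forall s s', K s -> K s' ->
    conv_hull (@vertices s) `&` conv_hull (@vertices s') =
    conv_hull (@vertices (s `&` s')%fset) }.

Definition maximal_simplex K s :=
  K s /\ forall s', K s' -> (s `<=` s')%fset -> s' = s.

Definition complex_dim K (n : nat) :=
  (exists2 s, K s & #|` s| = n.+1) /\ forall s, K s -> (#|` s| <= n.+1)%N.

Definition polyhedron K : set E := \bigcup_(s in K) conv_hull (@vertices s).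

(* w is a vertex of K and the polyhedron of K is a neighbourhood of w in H. *)
Definition interior_vertex (H : set E) K (w : E) :=
  K [fset w]%fset /\ within H (nbhs w) (polyhedron K).

Definition star_of_origin (H : set E) K :=
  (forall s, maximal_simplex K s -> 0 \in s) /\
  (forall w, interior_vertex H K w <-> w = 0).

(* For a = 0 and K nonempty this is the complex reduced to the origin. *)
Definition scale_complex (a : R) K : set {fset E} :=
  [set [fset a *: w | w in s]%fset | s in K].

(* All the nonempty faces of the joins w * V, for w a maximal simplex of K. *)
Definition join_complex K (V : {fset E}) : set {fset E} :=
  [set s | s != fset0 /\
     exists2 w, maximal_simplex K w & (s `<=` w `|` V)%fset].

Definition domain_points K (d : nat) : set E :=
  \bigcup_(s in K)
    [set domain_point (@vertices s) l | l in [set l | multi_index s d l]].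

End complexes.

Section splines.
Context {R : realType} {k : nat}.
Local Notation E := 'rV[R]_k.

Fixpoint Cr_function (r : nat) (g : E -> R) : Prop :=
  continuous g /\
  if r is r'.+1 then
    forall t : 'I_k, (forall x, derivable g x (delta_mx 0 t)) /\
      Cr_function r' (fun x => 'D_(delta_mx 0 t) g x)
  else True.

(* A function on a (closed) subset of R^k is C^r when it is the restriction of
   a C^r function on R^k.  This is independent of the ambient space, hence also
   suits complexes that are not full-dimensional. *)
Definition Cr_on (A : set E) (r : nat) (f : A -> R) : Prop :=
  exists2 g : E -> R, Cr_function r g & forall x : A, f x = g (val x).

(* msize is the total degree plus one (and 0 for the zero polynomial). *)
Definition poly_on (A B : set E) (d : nat) (f : A -> R) : Prop :=
  exists2 p : mpoly k R, (msize p <= d.+1)%N &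
    forall x : A, B (val x) -> f x = meval (fun t => val x 0 t) p.

Implicit Types (K : set {fset E}) (M : set E).

Definition spline_space K (r d : nat) : set (polyhedron K -> R) :=
  [set f | Cr_on r f /\ forall s, maximal_simplex K s ->
                          poly_on (conv_hull (@vertices R k s)) d f].

(* c gives the Bernstein-Bezier coefficients of f; only its values at the
   degree-d domain points of K matter. *)
Definition BB_coefficients K (d : nat) (f : polyhedron K -> R) (c : E -> R) :=
  forall s, maximal_simplex K s -> forall b : s -> R, is_weight b ->
  forall x : polyhedron K, val x = \sum_w b w *: vertices w ->
  f x = \sum_(l | multi_index s d l)
          c (domain_point (@vertices R k s) l) * bernstein l b.

Definition determining_set K (d : nat) (S : set (polyhedron K -> R)) M :=
  M `<=` domain_points K d /\
  forall f c, S f -> BB_coefficients d f c -> (forall p, M p -> c p = 0) ->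
  forall x, f x = 0.

Definition minimal_determining_set K (d : nat) (S : set (polyhedron K -> R)) M :=
  determining_set d S M /\ forall N, determining_set d S N -> (M #<= N)%card.

End splines.
Arguments spline_space {R k} K r d _.

Definition has_dim {R : realType} {T : Type} (S : set (T -> R)) (n : nat) :=
  exists e : 'I_n -> T -> R,
    [/\ forall t, S (e t),
        forall c : 'I_n -> R,
          (forall x, \sum_t c t * e t x = 0) -> forall t, c t = 0 &
        forall f, S f ->
          exists c : 'I_n -> R, forall x, f x = \sum_t c t * e t x].

(* Binomial coefficient with binom(-1,-1) = 1 and binom(m,-1) = 0 for m >= 0;
   the remaining values at negative arguments are irrelevant. *)
Definition binz (m n : int) : nat :=
  match m, n with
  | Posz m, Posz n => 'C(m, n)
  | Negz 0, Negz 0 => 1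
  | _, _ => 0
  end.

(* Main.v *)
(** Encode a spline by its coefficient function c on the domain points: c is
    admissible for a complex when some C^r function on R^k has, on every maximal
    simplex, the Bernstein form with coefficients c.  A barycentric form of degree
    d on w * v_1 * ... * v_m (m = k - i) splits, according to the multi-index J of
    the v_t, as the sum of binomial (d, |J|) * B_J (y) * H_J, where B_J is a
    Bernstein monomial and H_J is the form of degree j = d - |J| on w with
    coefficients c (. + xi_J).  The point is that c is admissible for O' iff every
    c (. + xi_J) is admissible for C_j.

    If g extends the spline, then by homogeneity the sum above is
    (1 + |y|)^d g ((x + sum_t y_t v_t) / (1 + |y|)) for all y >= 0, and H_J (x) is
    a fixed linear combination of its values at a grid of points y.  Conversely,
    since every maximal simplex of C contains O, H_J at mass u is a polynomial in u
    whose value at an integer a >= 1 is a^j g_J (x / a); Lagrange interpolation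
    expresses it as a C^r function of the point.

    So the coefficient space of O' is the direct sum of those of the C_j.  A
    minimal determining set is the same thing as a determining set with a dual
    family of coefficient functions, and dual families add up. *)

Require Import Defs.
From HB Require Import structures.
From mathcomp Require Import all_boot all_order all_algebra finmap.
From mathcomp Require Import all_classical all_reals all_analysis.
From mathcomp Require Import -(notations) mpoly.
From mathcomp Require Import ring.
Import Order.TTheory GRing.Theory Num.Theory.
Import numFieldNormedType.Exports.

Set Implicit Arguments.
Unset Strict Implicit.
Unset Printing Implicit Defensive.

Local Open Scope classical_set_scope.
Local Open Scope ring_scope.

(** * Functions of class C^r *)

Section smooth_functions.
Context {R : realType} {k : nat}.
Implicit Types (f g : 'rV[R]_k -> R) (r n : nat).

Lemma Cr_pred r f : Cr_function r.+1 f -> Cr_function r f.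
Proof.
elim: r f => [|r IHr] f [cf df]; first by split.
by split=> // t; have [dft /IHr Cft] := df t.
Qed.

Lemma Cr_cst r (a : R) : Cr_function r (fun _ : 'rV[R]_k => a).
Proof.
elim: r a => [|r IHr] a; split=> //; do ? by move=> x; exact: cst_continuous.
move=> t; split=> [x|]; first exact: derivable_cst.
by under eq_fun do rewrite derive_cst.
Qed.

Lemma CrD r f g :
  Cr_function r f -> Cr_function r g -> Cr_function r (fun x => f x + g x).
Proof.
elim: r f g => [|r IHr] f g [cf df] [cg dg]; split=> //; do ?
  by move=> x; apply: continuousD; [exact: cf|exact: cg].
move=> t; have [dft Cft] := df t; have [dgt Cgt] := dg t; split=> [x|].
  exact: derivableD.
rewrite (_ : (fun x => _) = fun x => 'D_'e_t f x + 'D_'e_t g x).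
  exact: IHr.
by apply/funext => x; rewrite -deriveD.
Qed.

Lemma CrM r f g :
  Cr_function r f -> Cr_function r g -> Cr_function r (fun x => f x * g x).
Proof.
elim: r f g => [|r IHr] f g [cf df] [cg dg]; split=> //; do ?
  by move=> x; apply: continuousM; [exact: cf|exact: cg].
move=> t; have [dft Cft] := df t; have [dgt Cgt] := dg t; split=> [x|].
  exact: derivableM.
rewrite (_ : (fun x => _) = fun x => f x * 'D_'e_t g x + g x * 'D_'e_t f x).
  by apply: CrD; apply: IHr => //; apply: Cr_pred; split.
by apply/funext => x; rewrite deriveM.
Qed.

Lemma CrZ r (a : R) f : Cr_function r f -> Cr_function r (fun x => a * f x).
Proof. by move=> Cf; apply: CrM => //; exact: Cr_cst. Qed.

Lemma Cr_sum r (I : Type) (s : seq I) (F : I -> 'rV[R]_k -> R) :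
  (forall i, Cr_function r (F i)) ->
  Cr_function r (fun x => \sum_(i <- s) F i x).
Proof.
move=> CF; elim: s => [|i s IHs].
  by under eq_fun do rewrite big_nil; exact: Cr_cst.
by under eq_fun do rewrite big_cons; exact: CrD.
Qed.

Lemma Cr_prod r (I : Type) (s : seq I) (F : I -> 'rV[R]_k -> R) :
  (forall i, Cr_function r (F i)) ->
  Cr_function r (fun x => \prod_(i <- s) F i x).
Proof.
move=> CF; elim: s => [|i s IHs].
  by under eq_fun do rewrite big_nil; exact: Cr_cst.
by under eq_fun do rewrite big_cons; exact: CrM.
Qed.

Lemma CrX r n f : Cr_function r f -> Cr_function r (fun x => f x ^+ n).
Proof.
move=> Cf; elim: n => [|n IHn]; first exact: Cr_cst.
by under eq_fun do rewrite exprS; exact: CrM.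
Qed.

Lemma Cr_horner r (p : {poly R}) f :
  Cr_function r f -> Cr_function r (fun x => p.[f x]).
Proof.
move=> Cf; under eq_fun do rewrite horner_coef.
by apply: Cr_sum => i; apply: CrZ; exact: CrX.
Qed.

Lemma Cr_coord r (t : 'I_k) : Cr_function r (fun x : 'rV[R]_k => x 0 t).
Proof.
case: r => [|r]; (split; first exact: coord_continuous) => // u.
have coord_u (x : 'rV[R]_k) :
    is_derive x (delta_mx 0 u : 'rV[R]_k) (fun x => x 0 t) ((t == u)%:R : R).
  have lim_u : (fun h : R => h^-1 *: (((fun x : 'rV[R]_k => x 0 t) \o shift x)
      (h *: 'e_u) - x 0 t)) @ 0^' --> ((t == u)%:R : R).
    apply: cvg_near_cst; near=> h => /=.
    rewrite !mxE eqxx /= addrK scalerA mulVf ?scale1r //.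
    by near: h; exact: nbhs_dnbhs_neq.
  by split; [apply/cvg_ex; eexists; exact: lim_u|exact: cvg_lim lim_u].
split=> [x|]; first by have [] := coord_u x.
under eq_fun do rewrite (@derive_val _ _ _ _ _ _ _ (coord_u _)).
exact: Cr_cst.
Unshelve. all: by end_near. Qed.

Lemma Cr_linear_form r (a : 'I_k -> R) :
  Cr_function r (fun x : 'rV[R]_k => \sum_u a u * x 0 u).
Proof. by apply: Cr_sum => u; apply: CrZ; exact: Cr_coord. Qed.

Lemma is_derive_scale_dir f (x w : 'rV[R]_k) (a : R) :
  derivable f x w -> is_derive x (a *: w) f (a * 'D_w f x).
Proof.
move=> dfx; have [->|a0] := eqVneq a 0.
  by rewrite scale0r mul0r; exact: is_derive0.
have mula_dnbhs : h * a @[h --> (0 : R)^'] --> (0 : R)^'.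
  have := @continuous_injective_withinNx _ _ (fun h : R => h * a) 0.
  rewrite mul0r; apply=> [|h /eqP]; first exact: mulrr_continuous.
  by rewrite mulf_eq0 (negPf a0) orbF => /eqP.
have lim_f : h^-1 *: ((f \o shift x) (h *: (a *: w)) - f x) @[h --> 0^']
             --> a * 'D_w f x.
  rewrite (_ : (fun h : R => _) =
      (fun h => a * ((h * a)^-1 *: ((f \o shift x) ((h * a) *: w) - f x)))).
    by apply: cvgM; [exact: cvg_cst|exact: (cvg_comp _ _ mula_dnbhs dfx)].
  apply/funext => h; rewrite scalerA -![_ *: (_ - _)]/(_ * _) mulrA.
  by rewrite invfM [_^-1 / _]mulrC mulVKf.
by split; [apply/cvg_ex; exists (a * 'D_w f x)|exact: cvg_lim lim_f].
Qed.

Lemma diag_affine_continuous (a b : 'rV[R]_k) :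
  continuous (fun x : 'rV[R]_k => x *m diag_mx a + b : 'rV[R]_k).
Proof.
rewrite (_ : (fun x => _) =
    (\sum_u fun y : 'rV[R]_k => (a 0 u * y 0 u) *: 'e_u : 'rV[R]_k) \+ cst b).
  move=> x; apply: continuousD; last exact: cst_continuous.
  elim/big_ind: _ => [|f g cf cg|u _].
  - exact: cst_continuous.
  - exact: continuousD.
  - apply: continuousZr_tmp; apply: continuousM; first exact: cst_continuous.
    exact: coord_continuous.
apply/funext => y /=; rewrite fct_sumE [_ *m _]row_sum_delta; congr (_ + b).
by apply: eq_bigr => u _; rewrite mul_mx_diag mxE mulrC.
Qed.

(* [Cr_function] only speaks of partial derivatives; a diagonal map sends
   coordinate directions to coordinate directions, so that the chain rule
   reduces to a rescaling of partial derivatives. *)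
Lemma Cr_diag_affine r (a b : 'rV[R]_k) f :
  Cr_function r f -> Cr_function r (fun x => f (x *m diag_mx a + b)).
Proof.
set L := fun x : 'rV[R]_k => x *m diag_mx a + b.
elim: r f => [|r IHr] f [cf df]; split=> //; do ?
  by move=> x; apply: continuous_comp;
    [exact: diag_affine_continuous|exact: cf].
move=> t; have [dft Cft] := df t.
have e_diag (h : R) x : L (h *: 'e_t + x) = h *: (a 0 t *: 'e_t) + L x.
  rewrite /L mulmxDl -scalemxAl -addrA; congr (_ *: _ + _); apply/rowP => u.
  by rewrite mul_mx_diag !mxE eqxx /= mulrC; case: eqP => [->|]; rewrite ?mulr0.
have dL x : is_derive x ('e_t : 'rV_k) (f \o L) (a 0 t * 'D_('e_t) f (L x)).
  have [] := is_derive_scale_dir (a 0 t) (dft (L x)).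
  rewrite /derivable /derive (_ : (fun h : R => _) =
      fun h => h^-1 *: ((f \o L \o shift x) (h *: 'e_t) - (f \o L) x)).
    by split.
  by apply/funext => h /=; rewrite e_diag.
split=> [x|]; first by have [] := dL x.
under eq_fun do rewrite (@derive_val _ _ _ _ _ _ _ (dL _)).
by apply: CrZ; exact: (IHr _ Cft).
Qed.

Lemma Cr_scale_translate r (a : R) (b : 'rV[R]_k) f :
  Cr_function r f -> Cr_function r (fun x => f (a *: x + b)).
Proof.
move=> /(Cr_diag_affine (const_mx a) b).
by under eq_fun do rewrite diag_const_mx mul_mx_scalar.
Qed.

End smooth_functions.

(** * Linear combinations of finite families *)

Section extension.
Context {I : finType} {J : eqType}.
Implicit Types (T : Type) (h : I -> J).

Definition extend T (z : T) h (l : I -> T) (j : J) : T :=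
  if [pick i | h i == j] is Some i then l i else z.

Lemma extendE T (z : T) h l i : injective h -> extend z h l (h i) = l i.
Proof.
move=> injh; rewrite /extend; case: pickP => [u /eqP/injh -> //|/(_ i)].
by rewrite eqxx.
Qed.

Lemma extend_notin T (z : T) h l j : j \notin codom h -> extend z h l j = z.
Proof. by rewrite /extend; case: pickP => // i /eqP <-; rewrite codom_f. Qed.

Lemma extend_restrict T (z : T) h (f : J -> T) :
  (forall j, j \notin codom h -> f j = z) -> extend z h (f \o h) = f.
Proof.
move=> f0; apply/funext => j; rewrite /extend; case: pickP => [i /eqP <- //|hj].
by rewrite f0 //; apply/codomP => -[i ji]; have := hj i; rewrite ji eqxx.
Qed.

Lemma map_extend T (U : Type) (f : T -> U) (z : T) h l j :
  f (extend z h l j) = extend (f z) h (f \o l) j.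
Proof. by rewrite /extend; case: pickP. Qed.

End extension.

Lemma extend_comp (I J : finType) (K : eqType) (T : Type) (z : T)
    (h : I -> J) (h' : J -> K) l :
  injective h -> injective h' ->
  extend z h' (extend z h l) = extend z (h' \o h) l.
Proof.
move=> injh injh'; rewrite -[LHS](@extend_restrict _ _ _ z (h' \o h)).
  by congr extend; apply/funext => i /=; rewrite !extendE.
move=> k; have [/codomP[j ->] hj|kh' _] := boolP (k \in codom h').
  rewrite extendE // extend_notin //; apply: contra hj => /codomP[i ->].
  exact: (codom_f (h' \o h)).
exact: extend_notin.
Qed.

Lemma extend_bij (I J : finType) (K : eqType) (T : Type) (z : T)
    (h : I -> J) (h' : J -> K) l : bijective h -> injective h' ->
  extend z h' l = extend z (h' \o h) (l \o h).
Proof.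
move=> [g hK gK] injh'; rewrite -extend_comp //; last exact: can_inj hK.
congr extend; apply/funext => j; rewrite -[j]gK extendE //; exact: can_inj hK.
Qed.

Section big_extend.
Context {I J : finType} {R : Type} {idx : R} {op : Monoid.com_law idx}.
Variable h : I -> J.
Hypothesis injh : injective h.

Lemma big_codom (F : J -> R) : (forall j, j \notin codom h -> F j = idx) ->
  \big[op/idx]_j F j = \big[op/idx]_i F (h i).
Proof.
move=> /big_rmcond <-; rewrite -big_uniq ?big_image //.
exact/injectiveP.
Qed.

Lemma big_extend (T : Type) (F : J -> T -> R) (z : T) (l : I -> T) :
  (forall j, F j z = idx) ->
  \big[op/idx]_j F j (extend z h l j) = \big[op/idx]_i F (h i) (l i).
Proof.
move=> F0; rewrite big_codom => [|j hj]; last by rewrite extend_notin.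
by apply: eq_bigr => i _; rewrite extendE.
Qed.

End big_extend.

Lemma sum_delta (R : pzSemiRingType) (I : finType) (i : I) :
  \sum_t ((t == i)%:R : R) = 1.
Proof. by rewrite (big_only1 i) ?eqxx // => t /negPf ->. Qed.

Section weights.
Context {R : realType}.
Implicit Types (I J : finType).

Lemma delta_weight I (i : I) : is_weight (fun t => (t == i)%:R : R).
Proof. by split=> [t|]; [exact: ler0n|exact: sum_delta]. Qed.

Lemma extend_weight I J (h : I -> J) (b : I -> R) :
  injective h -> is_weight b -> is_weight (extend 0 h b).
Proof.
move=> injh [b0 b1]; split=> [j|]; first by rewrite /extend; case: pickP.
by rewrite (big_extend injh (F := fun _ x => x)).
Qed.

Lemma normalized_weight I (b : I -> R) : (forall t, 0 <= b t) ->
  0 < \sum_t b t -> is_weight (fun t => (\sum_t b t)^-1 * b t).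
Proof.
move=> b0 b1; split=> [t|]; first by rewrite mulr_ge0 // invr_ge0 ltW.
by rewrite -mulr_sumr mulVf ?gt_eqF.
Qed.

End weights.

Definition case_sum {I J T : Type} (a : I -> T) (b : J -> T) (x : I + J) : T :=
  match x with inl i => a i | inr j => b j end.

Lemma extend_case_sum (I K : finType) (J : eqType) (T : Type) (z : T)
    (h : I -> J) (h' : K -> J) (b : I + K -> T) : injective (case_sum h h') ->
  extend z (case_sum h h') b =
  fun j => if j \in codom h' then extend z h' (b \o inr) j
           else extend z h (b \o inl) j.
Proof.
move=> injhh'; apply/funext => j.
have injh : injective h.
  by move=> i i' ii'; case: (injhh' (inl i) (inl i') ii').
have injh' : injective h'.
  by move=> i i' ii'; case: (injhh' (inr i) (inr i') ii').
case: ifPn => [/codomP[t ->]|jh'].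
  by rewrite -[h' t]/(case_sum h h' (inr t)) extendE // [RHS]extendE.
have [/codomP[i ->]|jh] := boolP (j \in codom h).
  by rewrite -[h i]/(case_sum h h' (inl i)) extendE // [RHS]extendE.
rewrite !extend_notin //; apply/codomP => -[[i|t] /= ji].
  by case/negP: jh; rewrite ji codom_f.
by case/negP: jh'; rewrite ji codom_f.
Qed.

Section linear_combinations.
Context {R : pzRingType} {V : lmodType R}.
Implicit Types (I J : finType).

Definition lincomb I (b : I -> R) (w : I -> V) : V := \sum_t b t *: w t.

Definition linearly_independent I (w : I -> V) : Prop :=
  forall b, lincomb b w = 0 -> forall t, b t = 0.

Lemma lincomb_delta I (w : I -> V) i : lincomb (fun t => (t == i)%:R) w = w i.
Proof.
rewrite /lincomb (big_only1 i) ?eqxx ?scale1r // => t /negPf -> _.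
by rewrite scale0r.
Qed.

Lemma lincomb0 I (w : I -> V) : lincomb (fun=> 0) w = 0.
Proof. by rewrite /lincomb big1 // => t _; rewrite scale0r. Qed.

Lemma lincombD I (b b' : I -> R) w :
  lincomb (fun t => b t + b' t) w = lincomb b w + lincomb b' w.
Proof.
by rewrite /lincomb -big_split; apply: eq_bigr => t _; rewrite scalerDl.
Qed.

Lemma lincombB I (b b' : I -> R) w :
  lincomb (fun t => b t - b' t) w = lincomb b w - lincomb b' w.
Proof. by rewrite /lincomb -sumrB; apply: eq_bigr => t _; rewrite scalerBl. Qed.

Lemma lincombZ I (a : R) (b : I -> R) w :
  lincomb (fun t => a * b t) w = a *: lincomb b w.
Proof.
by rewrite /lincomb scaler_sumr; apply: eq_bigr => t _; rewrite scalerA.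
Qed.

Lemma lincomb_extend I J (h : I -> J) (b : I -> R) w :
  injective h -> lincomb (extend 0 h b) w = lincomb b (w \o h).
Proof.
move=> injh; apply: (big_extend injh (F := fun j x => x *: w j)) => j.
by rewrite scale0r.
Qed.

Lemma lincomb_bij I J (h : I -> J) (b : J -> R) w :
  bijective h -> lincomb b w = lincomb (b \o h) (w \o h).
Proof. by move=> bijh; rewrite /lincomb (reindex h) //; exact: onW_bij. Qed.

Lemma lincomb_case_sum I J (b : I + J -> R) (w : I -> V) (w' : J -> V) :
  lincomb b (case_sum w w') = lincomb (b \o inl) w + lincomb (b \o inr) w'.
Proof. by rewrite /lincomb big_sumType. Qed.

Lemma lincomb_inj I (w : I -> V) (b b' : I -> R) : linearly_independent w ->
  lincomb b w = lincomb b' w -> b =1 b'.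
Proof.
move=> freew bb' t; apply/eqP; rewrite -subr_eq0; apply/eqP.
by apply: (freew (fun t => b t - b' t)); rewrite lincombB bb' subrr.
Qed.

End linear_combinations.

Lemma linear_lincomb (R : pzRingType) (V W : lmodType R) (f : {linear V -> W})
    (I : finType) (b : I -> R) (w : I -> V) :
  f (lincomb b w) = lincomb b (f \o w).
Proof.
by rewrite /lincomb linear_sum; apply: eq_bigr => t _; rewrite linearZ.
Qed.

Section independent_families.
Context {R : nzRingType} {V : lmodType R} {I : finType} {w : I -> V}.
Hypothesis freew : linearly_independent w.

Lemma linearly_independent_inj : injective w.
Proof.
move=> i j ij; have := @lincomb_inj _ _ _ w (fun t => (t == i)%:R)
  (fun t => (t == j)%:R) freew; rewrite !lincomb_delta => /(_ ij i).
by rewrite eqxx; case: eqP => // _ /eqP; rewrite oner_eq0.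
Qed.

Lemma linearly_independent_neq0 i : w i != 0.
Proof.
apply/eqP => wi0; have := freew (b := fun t => (t == i)%:R).
by rewrite lincomb_delta => /(_ wi0 i)/eqP; rewrite eqxx oner_eq0.
Qed.

End independent_families.

Section coordinates.
Context {F : fieldType} {n : nat} {I : finType}.
Implicit Types (w : I -> 'rV[F]_n).

Lemma lincomb_mulmx w b : lincomb b w =
  (\row_(i < #|I|) b (enum_val i)) *m \matrix_(i < #|I|) w (enum_val i).
Proof.
rewrite mulmx_sum_row /lincomb big_enum_val; apply: eq_bigr => i _.
by rewrite rowK mxE.
Qed.

Lemma linearly_independent_row_free w :
  linearly_independent w -> row_free (\matrix_(i < #|I|) w (enum_val i)).
Proof.
move=> freew; apply: inj_row_free => x.
rewrite (_ : x = \row_i x 0 (enum_rank (enum_val i))).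
  rewrite -(lincomb_mulmx w (fun t => x 0 (enum_rank t))) => /freew x0.
  by apply/rowP => i; rewrite !mxE x0.
by apply/rowP => i; rewrite mxE enum_valK.
Qed.

Lemma linearly_independent_card w : linearly_independent w -> (#|I| <= n)%N.
Proof.
by move=> /linearly_independent_row_free/eqP <-; exact: rank_leq_col.
Qed.

Lemma linearly_independent_coordinates w : linearly_independent w ->
  exists beta : I -> 'I_n -> F, forall b t,
    \sum_u beta t u * lincomb b w 0 u = b t.
Proof.
move=> /linearly_independent_row_free; set A := \matrix_i _ => freeA.
exists (fun t u => pinvmx A u (enum_rank t)) => b t.
have := mulmxKp freeA (\row_(i < #|I|) b (enum_val i)).
rewrite -lincomb_mulmx => /rowP/(_ (enum_rank t)).
rewrite !mxE enum_rankK => <-.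
by apply: eq_bigr => u _; rewrite mulrC.
Qed.

End coordinates.

Lemma barycentric_coordinates (R : realType) (k : nat) (I : finType)
    (v : I -> 'rV[R]_k) : affinely_independent v ->
  exists (beta : I -> 'I_k -> R) (gamma : I -> R), forall b, \sum_t b t = 1 ->
    forall t, b t = \sum_u beta t u * lincomb b v 0 u + gamma t.
Proof.
move=> affv; pose w t : 'rV[R]_(k + 1) := row_mx (v t) (1 : 'rV_1).
have lincomb_w b : lincomb b w = row_mx (lincomb b v) (const_mx (\sum_t b t)).
  apply/rowP => j; rewrite /lincomb summxE; case: (split_ordP j) => u ->.
    by rewrite row_mxEl summxE; apply: eq_bigr => t _; rewrite mxE row_mxEl mxE.
  rewrite row_mxEr mxE; apply: eq_bigr => t _.
  by rewrite mxE row_mxEr (ord1 u) mxE mulr1.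
have [b|beta betaP] := @linearly_independent_coordinates _ _ _ w.
  rewrite lincomb_w => /eqP; rewrite row_mx_eq0.
  move=> /andP[/eqP b0 /eqP/rowP/(_ 0)].
  by rewrite !mxE => b1; exact: affv.
exists (fun t u => beta t (lshift 1 u)), (fun t => beta t (rshift k 0)).
move=> b b1 t.
rewrite -[LHS]betaP lincomb_w b1 big_split_ord /= big_ord1 row_mxEr mxE mulr1.
by congr (_ + _); apply: eq_bigr => u _; rewrite row_mxEl.
Qed.

(** * Bernstein forms *)

Section multi_indices.
Context {I : finType}.
Implicit Types (N : nat).

Definition entries N (l : {ffun I -> 'I_N.+1}) (t : I) : nat := l t.

Definition of_entries N (l : I -> nat) : {ffun I -> 'I_N.+1} :=
  [ffun t => inord (l t)].

Lemma entries_leq N (l : {ffun I -> 'I_N.+1}) t : (entries l t <= N)%N.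
Proof. by rewrite -ltnS ltn_ord. Qed.

Lemma entriesK N : cancel (@entries N) (of_entries N).
Proof. by move=> l; apply/ffunP => t; rewrite ffunE inord_val. Qed.

Lemma of_entriesK N l :
  (forall t, (l t <= N)%N) -> entries (of_entries N l) = l.
Proof.
by move=> lN; apply/funext => t; rewrite /entries ffunE inordK ?ltnS.
Qed.

Lemma multi_indexE N (l : {ffun I -> 'I_N.+1}) :
  multi_index I N l = ((\sum_t entries l t)%N == N).
Proof. by []. Qed.

Lemma leq_sum_entry (l : I -> nat) t : (l t <= \sum_t l t)%N.
Proof. by rewrite (bigD1 t) //= leq_addr. Qed.

Lemma of_entries_sumK N l :
  (\sum_t l t <= N)%N -> entries (of_entries N l) = l.
Proof.
by move=> lN; apply: of_entriesK => t; rewrite (leq_trans _ lN) ?leq_sum_entry.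
Qed.

End multi_indices.

Section lagrange.
Context {R : numFieldType}.

Definition node_poly n (i : 'I_n.+1) : {poly R} :=
  tnth (lagrange n.+1 (fun i => i.+1%:R)) i.

Lemma lagrange_interpolation n (p : {poly R}) : (size p <= n.+1)%N ->
  p = \sum_(i < n.+1) p.[i.+1%:R] *: node_poly i.
Proof.
move=> pn; rewrite [LHS](lagrange_gen (x := fun i => i.+1%:R) _ _ pn) //.
  by apply: eq_bigr => i _; rewrite mul_polyC.
by move=> i j /eqP; rewrite eqr_nat => /eqP [].
Qed.

Lemma coef_node_poly_dual n (m m' : 'I_n.+1) :
  \sum_(i < n.+1) (node_poly i)`_m * i.+1%:R ^+ m' = (m == m')%:R :> R.
Proof.
have := lagrange_interpolation (n := n) (p := 'X^m').
rewrite size_polyXn => /(_ (ltn_ord m'))/(congr1 (fun p : {poly R} => p`_m)).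
rewrite coefXn coef_sum => ->; apply: eq_bigr => i _.
by rewrite coefZ hornerXn mulrC.
Qed.

End lagrange.

Section bernstein_forms.
Context {R : numFieldType}.
Implicit Types (I J K : finType) (n N : nat).

Definition bmonomial n I (l : I -> nat) (b : I -> R) : R :=
  n`!%:R / (\prod_t (l t)`!)%:R * \prod_t b t ^+ l t.

Lemma fact_neq0 n : n`!%:R != 0 :> R.
Proof. by rewrite pnatr_eq0 -lt0n fact_gt0. Qed.

Lemma prod_fact_neq0 I (l : I -> nat) : (\prod_t (l t)`!)%:R != 0 :> R.
Proof. by rewrite pnatr_eq0 -lt0n prodn_gt0 // => t; exact: fact_gt0. Qed.

Lemma bmonomial_extend I J (h : I -> J) n (l : I -> nat) b : injective h ->
  bmonomial n (extend 0%N h l) b = bmonomial n l (b \o h).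
Proof.
move=> injh; rewrite /bmonomial (big_extend injh (F := fun _ x => x`!)) //.
by rewrite (big_extend injh (F := fun j x => b j ^+ x)) // => j; exact: expr0.
Qed.

Lemma bmonomial_eq0 n I (l : I -> nat) b t :
  b t = 0 -> l t != 0%N -> bmonomial n l b = 0.
Proof.
move=> bt /negPf lt; rewrite /bmonomial [X in _ * X](bigD1 t) //=.
by rewrite bt expr0n lt mul0r mulr0.
Qed.

Lemma bmonomialZ n I (l : I -> nat) s b : (\sum_t l t)%N = n ->
  bmonomial n l (fun t => s * b t) = s ^+ n * bmonomial n l b.
Proof.
move=> <-; rewrite /bmonomial; under [X in _ * X]eq_bigr do rewrite exprMn.
by rewrite big_split prodrXr /= mulrCA.
Qed.

Lemma bmonomial_case_sum I K n (l : I -> nat) (j : K -> nat) b :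
  (\sum_t j t <= n)%N ->
  bmonomial n (case_sum l j) b =
  'C(n, \sum_t j t)%:R * bmonomial (\sum_t j t) j (b \o inr) *
    bmonomial (n - \sum_t j t) l (b \o inl).
Proof.
move=> jn; rewrite /bmonomial !big_sumType /= -(bin_fact jn) !natrM.
by field; rewrite !prod_fact_neq0.
Qed.

Lemma bmonomial_grid_dual K N (j0 : {ffun K -> 'I_N.+1}) :
  exists lam : {ffun K -> 'I_N.+1} -> R, forall j : {ffun K -> 'I_N.+1},
    \sum_y lam y * bmonomial (\sum_t j t) (entries j) (fun t => (y t).+1%:R) =
    (j == j0)%:R.
Proof.
pose coeff (j : {ffun K -> 'I_N.+1}) : R :=
  (\sum_t j t)`!%:R / (\prod_t (entries j t)`!)%:R.
have coeff_neq0 : coeff j0 != 0.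
  by rewrite mulf_neq0 ?fact_neq0 // invr_neq0 // prod_fact_neq0.
exists (fun y => (coeff j0)^-1 * \prod_t (node_poly (y t))`_(j0 t)) => j.
transitivity ((coeff j0)^-1 * coeff j * \sum_(y : {ffun K -> 'I_N.+1})
    \prod_t ((node_poly (y t))`_(j0 t) * (y t).+1%:R ^+ j t)).
  rewrite mulr_sumr; apply: eq_bigr => y _.
  by rewrite big_split /bmonomial /= -/(coeff j); ring.
rewrite -(bigA_distr_bigA (fun t (i : 'I_N.+1) =>
  (node_poly i)`_(j0 t) * i.+1%:R ^+ j t)) /=.
under eq_bigr do rewrite coef_node_poly_dual.
have [->|jj0] := eqVneq j j0.
  by rewrite big1 ?mulr1 ?mulVf // => t _; rewrite eqxx.
have /forallPn[t /negPf jt] : ~~ [forall t, j0 t == j t].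
  by apply: contra jj0 => /eqfunP j0E; apply/eqP/ffunP => t; rewrite j0E.
by rewrite (bigD1 t) //= jt mul0r mulr0.
Qed.

Definition bform n I (b : I -> R) (a : (I -> nat) -> R) : R :=
  \sum_(l | multi_index I n l) a (entries l) * bmonomial n (entries l) b.

Lemma bform_is_scalar n I (b : I -> R) : scalar (bform n b).
Proof.
move=> s a a'; rewrite /bform mulr_sumr -big_split; apply: eq_bigr => l _ /=.
by rewrite -[LHS]/((s * a _ + a' _) * _) mulrDl -mulrA.
Qed.

HB.instance Definition _ n I (b : I -> R) :=
  GRing.isLinear.Build R ((I -> nat) -> R) R *%R (bform n b)
    (bform_is_scalar n b).

Lemma eq_bform n I (b : I -> R) a a' :
  (forall l, (\sum_t l t)%N = n -> a l = a' l) -> bform n b a = bform n b a'.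
Proof. by move=> aa'; apply: eq_bigr => l /eqP ln; rewrite aa'. Qed.

Lemma bform_deg0 I (b : I -> R) a : bform 0 b a = a (fun=> 0%N).
Proof.
rewrite /bform (big_pred1 (of_entries 0 (fun=> 0%N))) => [|l]; last first.
  rewrite /multi_index; apply/eqP/eqP => [_|->].
    by apply/ffunP => t; rewrite !ord1.
  by rewrite big1 // => t _; rewrite ord1.
rewrite of_entriesK // /bmonomial !big1 ?divr1 ?mulr1 // => t _; exact: expr0.
Qed.

Lemma bform_widen n N I (b : I -> R) a : (n <= N)%N ->
  bform n b a = \sum_(l : {ffun I -> 'I_N.+1} | (\sum_t l t)%N == n)
                  a (entries l) * bmonomial n (entries l) b.
Proof.
move=> nN; have widenK (l : {ffun I -> 'I_n.+1}) :
    entries (of_entries N (entries l)) = entries l.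
  by apply: of_entriesK => t; rewrite (leq_trans (entries_leq l t)).
have narrowK (l : {ffun I -> 'I_N.+1}) : (\sum_t l t)%N == n ->
    entries (of_entries n (entries l)) = entries l.
  by move=> /eqP ln; rewrite of_entries_sumK // ln.
rewrite [RHS](reindex_onto (fun l => of_entries N (entries l))
  (fun l => of_entries n (entries l))) => [|l /narrowK ln]; last first.
  by rewrite ln entriesK.
apply: eq_big => [l|l _]; last by rewrite widenK.
by rewrite -/(\sum_t entries _ t)%N widenK entriesK eqxx andbT.
Qed.

Lemma bformZ n I (b : I -> R) s a :
  bform n (fun t => s * b t) a = s ^+ n * bform n b a.
Proof.
rewrite /bform mulr_sumr; apply: eq_bigr => l /eqP ln.
by rewrite bmonomialZ // mulrCA.
Qed.

Lemma bform_extend n I J (h : I -> J) (b : I -> R) a : injective h ->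
  bform n (extend 0 h b) a = bform n b (fun l => a (extend 0%N h l)).
Proof.
move=> injh.
pose pad (l : {ffun I -> 'I_n.+1}) := of_entries n (extend 0%N h (entries l)).
have entries_pad l : entries (pad l) = extend 0%N h (entries l).
  apply: of_entriesK => j; rewrite (map_extend (fun x => x <= n)%N) /extend.
  by case: pickP => // i _; exact: entries_leq.
have inj_pad : injective pad.
  move=> l l' ll'; rewrite -[l]entriesK -[l']entriesK; congr of_entries.
  apply/funext => i; rewrite -(extendE 0%N (entries l) i injh).
  by rewrite -entries_pad ll' entries_pad extendE.
rewrite /bform big_mkcond [RHS]big_mkcond (big_codom inj_pad) => [|l' l'_pad].
  apply: eq_bigr => l _; rewrite entries_pad bmonomial_extend //.
  rewrite (_ : _ \o h = b); last by apply/funext => i /=; rewrite extendE.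
  congr (if _ then _ else _); rewrite !multi_indexE entries_pad.
  by rewrite (big_extend injh (F := fun _ x => x)).
case: ifP => // _.
have [/existsP[j /andP[hj l'j]]|/existsPn l'0] :=
    boolP [exists j, (j \notin codom h) && (entries l' j != 0%N)].
  by rewrite (bmonomial_eq0 _ (t := j)) ?mulr0 ?extend_notin.
case/negP: l'_pad; apply/codomP; exists (of_entries n (entries l' \o h)).
rewrite -[l']entriesK /pad of_entriesK => [|i]; last exact: entries_leq.
rewrite extend_restrict ?entriesK // => j hj.
by have := l'0 j; rewrite hj negbK => /eqP.
Qed.

Lemma bform_bij n I J (h : I -> J) (b : J -> R) a : bijective h ->
  bform n b a = bform n (b \o h) (fun l => a (extend 0%N h l)).
Proof.
move=> bijh; rewrite -bform_extend ?extend_restrict //; last exact: bij_inj.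
by move=> j; case: bijh => h' _ h'K /codomP[]; exists (h' j).
Qed.

Lemma bform_case_sum n I K (b : I + K -> R) a :
  bform n b a = \sum_(j : {ffun K -> 'I_n.+1} | (\sum_t j t <= n)%N)
    'C(n, \sum_t j t)%:R * bmonomial (\sum_t j t) (entries j) (b \o inr) *
    bform (n - \sum_t j t) (b \o inl) (fun l => a (case_sum l (entries j))).
Proof.
pose glue_index (p : {ffun K -> 'I_n.+1} * {ffun I -> 'I_n.+1}) :=
  of_entries n (case_sum (entries p.2) (entries p.1)).
have entries_glue p :
    entries (glue_index p) = case_sum (entries p.2) (entries p.1).
  by apply: of_entriesK => -[i|t]; exact: entries_leq.
have bij_glue : bijective glue_index.
  exists (fun l =>
    (of_entries n (entries l \o inr), of_entries n (entries l \o inl))).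
    by move=> [j l]; rewrite entries_glue /=; congr pair; exact: entriesK.
  move=> l; rewrite /glue_index !of_entriesK;
    try by move=> ?; exact: entries_leq.
  by rewrite -[RHS]entriesK; congr of_entries; apply/funext => -[].
rewrite {1}/bform (reindex glue_index) /=; last exact: onW_bij.
pose summand (j : {ffun K -> 'I_n.+1}) (l : {ffun I -> 'I_n.+1}) : R :=
  if (\sum_t l t + \sum_t j t == n)%N
  then let lj := case_sum (entries l) (entries j) in a lj * bmonomial n lj b
  else 0.
rewrite big_mkcond (eq_bigr (fun p => summand p.1 p.2)) => [|p _]; last first.
  by rewrite multi_indexE entries_glue big_sumType.
rewrite -(pair_bigA _ summand) [RHS]big_mkcond; apply: eq_bigr => j _ /=.
rewrite -big_mkcond; case: leqP => jn; last first.
  by rewrite big_pred0 // => l; rewrite gtn_eqF // (leq_trans jn) // leq_addl.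
rewrite (bform_widen _ _ (leq_subr _ n)) mulr_sumr.
apply: eq_big => [l|l _]; first by rewrite -[RHS](eqn_add2r (\sum_t j t)) subnK.
by rewrite /= bmonomial_case_sum // mulrCA.
Qed.

Lemma bform_line_poly n I (b b' : I -> R) a :
  exists2 p : {poly R}, (size p <= n.+1)%N &
    forall z, p.[z] = bform n (fun t => b t + z * b' t) a.
Proof.
pose q (l : I -> nat) : {poly R} := \prod_t ((b t)%:P + b' t *: 'X) ^+ l t.
have size_q l : (size (q l) <= (\sum_t l t).+1)%N.
  rewrite /q; elim/big_ind2: _ => [|p1 m1 p2 m2 le1 le2|t _].
  - by rewrite size_poly1.
  - apply: leq_trans (size_polyMleq _ _) _.
    by rewrite -subn1 leq_subLR add1n -addSn -addnS leq_add.
  - have size_line : (size ((b t)%:P + b' t *: 'X)%R <= 2)%N.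
      rewrite (leq_trans (size_polyD _ _)) // geq_max.
      rewrite (leq_trans (size_polyC_leq1 _)) //.
      by rewrite (leq_trans (size_scale_leq _ _)) // size_polyX.
    apply: leq_trans (size_poly_exp_leq _ _) _.
    by rewrite ltnS -[leqRHS]mul1n leq_mul // -subn1 leq_subLR.
exists (\sum_(l | multi_index I n l)
    (a (entries l) * (n`!%:R / (\prod_t (entries l t)`!)%:R)) *: q (entries l)).
  apply: leq_trans (size_sum _ _ _) _; apply/bigmax_leqP => l /eqP ln.
  apply: leq_trans (size_scale_leq _ _) _.
  by rewrite -[X in (_ <= X.+1)%N]ln size_q.
move=> z; rewrite horner_sum; apply: eq_bigr => l _.
rewrite hornerZ -mulrA /q horner_prod; congr (_ * (_ * _)).
by apply: eq_bigr => t _; rewrite horner_exp !hornerE mulrC.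
Qed.

End bernstein_forms.

Lemma bform_eq0 (R : realType) (I : finType) (t0 : I) n (a : (I -> nat) -> R) :
  (forall b, is_weight b -> bform n b a = 0) ->
  forall l, (\sum_t l t)%N = n -> a l = 0.
Proof.
move=> a0 l ln.
have [lam lamP] := bmonomial_grid_dual (R := R) (of_entries n l).
have entriesl : entries (of_entries n l) = l by rewrite of_entries_sumK ?ln.
have grid0 (y : {ffun I -> 'I_n.+1}) : bform n (fun t => (y t).+1%:R) a = 0.
  have y0 : 0 < \sum_t (y t).+1%:R :> R.
    by rewrite (bigD1 t0) //= ltr_pwDl ?ltr0n // sumr_ge0.
  have /a0 : is_weight (fun t => (\sum_t (y t).+1%:R)^-1 * (y t).+1%:R : R).
    exact: normalized_weight.
  rewrite bformZ => /eqP; rewrite mulf_eq0 expf_eq0 invr_eq0 (gt_eqF y0) andbF.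
  by move=> /eqP.
transitivity (\sum_y lam y * bform n (fun t => (y t).+1%:R) a); last first.
  by rewrite big1 // => y _; rewrite grid0 mulr0.
under eq_bigr => y _ do rewrite /bform mulr_sumr.
rewrite exchange_big /=.
transitivity (\sum_(l' | multi_index I n l')
    a (entries l') * (l' == of_entries n l)%:R).
  rewrite (big_only1 (of_entries n l)) ?eqxx ?mulr1 ?entriesl //.
    by rewrite multi_indexE entriesl ln.
  by move=> l' /negPf -> _; rewrite mulr0.
apply: eq_bigr => l' /eqP l'n.
by rewrite -lamP l'n mulr_sumr; apply: eq_bigr => y _; rewrite mulrCA.
Qed.

Lemma bform_case_sum_extract (R : numFieldType) n (K : finType)
    (j0 : {ffun K -> 'I_n.+1}) : (\sum_t j0 t <= n)%N ->
  exists lam : {ffun K -> 'I_n.+1} -> R, forall (I : finType) (b : I -> R) a,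
    \sum_y lam y * bform n (case_sum b (fun t => (y t).+1%:R)) a =
    bform (n - \sum_t j0 t) b (fun l => a (case_sum l (entries j0))).
Proof.
move=> j0n; have [lam lamP] := bmonomial_grid_dual (R := R) j0.
have bin_neq0 : 'C(n, \sum_t j0 t)%:R != 0 :> R.
  by rewrite pnatr_eq0 -lt0n bin_gt0.
exists (fun y => 'C(n, \sum_t j0 t)%:R^-1 * lam y) => I b a.
pose piece (j : {ffun K -> 'I_n.+1}) :=
  bform (n - \sum_t j t) b (fun l => a (case_sum l (entries j))).
transitivity (\sum_(j : {ffun K -> 'I_n.+1} | (\sum_t j t <= n)%N)
    'C(n, \sum_t j0 t)%:R^-1 * ('C(n, \sum_t j t)%:R * piece j) * (j == j0)%:R).
  under [LHS]eq_bigr => y _ do rewrite bform_case_sum mulr_sumr.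
  rewrite exchange_big; apply: eq_bigr => j _ /=.
  rewrite -lamP mulr_sumr; apply: eq_bigr => y _.
  by rewrite -[bform _ _ _]/(piece j); ring.
rewrite (big_only1 j0) // => [|j /negPf -> _]; last by rewrite mulr0.
by rewrite eqxx mulr1 mulKf.
Qed.

Section forms_on_families.
Context {R : realType} {V : lmodType R}.
Implicit Types (I J : finType) (n : nat) (g : V -> R).

Definition has_bform n I (w : I -> V) (a : (I -> nat) -> R) g : Prop :=
  forall b, is_weight b -> g (lincomb b w) = bform n b a.

Lemma has_bform0 n I (w : I -> V) : has_bform n w 0 0.
Proof. by move=> b _; rewrite linear0. Qed.

Lemma has_bformP n I (w : I -> V) s a a' g g' : has_bform n w a g ->
  has_bform n w a' g' -> has_bform n w (s *: a + a') (s *: g + g').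
Proof. by move=> ag ag' b wb; rewrite linearP /= -ag -?ag'. Qed.

Lemma bform_unique n I (t0 : I) (w : I -> V) a a' g :
  has_bform n w a g -> has_bform n w a' g ->
  forall l, (\sum_t l t)%N = n -> a l = a' l.
Proof.
move=> ag a'g l ln; apply/eqP; rewrite -subr_eq0; apply/eqP.
apply: (bform_eq0 t0 (a := a - a')) ln => b wb.
by rewrite linearB /= -ag // -a'g // subrr.
Qed.

Lemma has_bform_cone n I (w : I -> V) a g b : has_bform n w a g ->
  (forall t, 0 <= b t) -> 0 < \sum_t b t ->
  bform n b a = (\sum_t b t) ^+ n * g ((\sum_t b t)^-1 *: lincomb b w).
Proof.
move=> ag b0 mass0; rewrite -lincombZ ag; last exact: normalized_weight.
by rewrite bformZ mulrA -exprMn mulfV ?gt_eqF // expr1n mul1r.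
Qed.

Lemma has_bform_extend n I J (h : I -> J) (w : J -> V) a g : injective h ->
  has_bform n w a g -> has_bform n (w \o h) (fun l => a (extend 0%N h l)) g.
Proof.
move=> injh ag b wb; rewrite -lincomb_extend // -bform_extend // ag //.
exact: extend_weight.
Qed.

Lemma has_bform_bij n I J (h : I -> J) (w : J -> V) a g : bijective h ->
  has_bform n w a g <-> has_bform n (w \o h) (fun l => a (extend 0%N h l)) g.
Proof.
move=> bijh; split=> ag; first exact: has_bform_extend (bij_inj bijh) ag.
move=> b [b0 b1]; rewrite (lincomb_bij _ _ bijh) (bform_bij _ _ _ bijh) ag //.
by split=> [t|]; [exact: b0|rewrite -b1 [RHS](reindex h) //; exact: onW_bij].
Qed.

Lemma has_bform_scale n I (s : R) (w : I -> V) a g :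
  has_bform n (fun t => s *: w t) a g <-> has_bform n w a (fun x => g (s *: x)).
Proof.
have lincombZr b : lincomb b (fun t => s *: w t) = s *: lincomb b w.
  rewrite /lincomb scaler_sumr; apply: eq_bigr => t _.
  by rewrite !scalerA mulrC.
by split=> ag b wb; have := ag b wb; rewrite lincombZr.
Qed.

(* On the line through b in the direction of the vertex 0, the form is a
   polynomial P in the mass of the argument, and P z = z ^ n g (x / z) as soon
   as z >= 1, so that P can be interpolated at z = 1, ..., n + 1. *)
Lemma star_bform_interpolation n I (t0 : I) (w : I -> V) a g b :
  w t0 = 0 -> has_bform n w a g -> (forall t, 0 <= b t) -> \sum_t b t <= 1 ->
  bform n b a = \sum_(i < n.+1) (node_poly i).[(\sum_t b t)] *
    (i.+1%:R ^+ n * g (i.+1%:R^-1 *: lincomb b w)).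
Proof.
move=> w0 ag b0; set u := \sum_t b t => u1.
pose line z t : R := b t + z * (t == t0)%:R.
have [p size_p pE] := bform_line_poly n b (fun t => (t == t0)%:R) a.
have mass_line z : \sum_t line z t = u + z.
  by rewrite big_split -mulr_sumr sum_delta mulr1.
have pE1 z : 1 <= z -> p.[z - u] = z ^+ n * g (z^-1 *: lincomb b w).
  move=> z1; have massE : z = \sum_t line (z - u) t.
    by rewrite mass_line addrC subrK.
  rewrite pE (has_bform_cone (w := w) ag) -/(line (z - u)) -?massE.
  - by rewrite lincombD lincombZ lincomb_delta w0 scaler0 addr0.
  - by move=> t; rewrite addr_ge0 // mulr_ge0 // subr_ge0 (le_trans u1).
  - by rewrite (lt_le_trans ltr01).
have -> : bform n b a = (p \Po ('X - u%:P)).[u].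
  rewrite horner_comp !hornerE subrr pE; congr bform; apply/funext => t.
  by rewrite mul0r addr0.
rewrite [p \Po _](lagrange_interpolation (n := n)); last first.
  by rewrite size_comp_poly2 ?size_XsubC.
rewrite horner_sum; apply: eq_bigr => i _.
by rewrite hornerZ mulrC horner_comp hornerXsubC pE1 ?ler1n.
Qed.

End forms_on_families.

Lemma msize_mul_leq m (R : idomainType) (p q : mpoly m R) i j :
  (msize p <= i.+1)%N -> (msize q <= j.+1)%N -> (msize (p * q) <= (i + j).+1)%N.
Proof.
move=> pi qj; have [->|p0] := eqVneq p 0; first by rewrite mul0r mmeasure0.
have [->|q0] := eqVneq q 0; first by rewrite mulr0 mmeasure0.
by rewrite msizeM // -subn1 leq_subLR add1n -addSn -addnS leq_add.
Qed.

Lemma msize_prod_exp_leq m (R : idomainType) (I : finType)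
    (beta : I -> mpoly m R) (l : I -> nat) :
  (forall t, msize (beta t) <= 2)%N ->
  (msize (\prod_t beta t ^+ l t) <= (\sum_t l t).+1)%N.
Proof.
move=> beta2; elim/big_ind2: _ => [|p i q j|t _]; first by rewrite msize1.
  exact: msize_mul_leq.
elim: (l t) => [|e IHe]; first by rewrite expr0 msize1.
by rewrite exprS; exact: (@msize_mul_leq _ _ _ _ 1 e).
Qed.

Lemma dhomog_linear_form m (R : nzRingType) (c : 'I_m -> R) :
  \sum_i c i *: mpolyX R (mnm1 i) \is ishomog1 1 mdeg.
Proof.
by apply: rpred_sum => i _; apply: dhomogZ; rewrite dhomogX /= mdeg1.
Qed.

Lemma dhomog_prod_exp m (R : comNzRingType) (J : finType) (q : J -> mpoly m R)
    (e : J -> nat) : (forall j, q j \is ishomog1 1 mdeg) ->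
  \prod_j q j ^+ e j \is ishomog1 (\sum_j e j) mdeg.
Proof.
move=> hq; elim/big_ind2: _ => [|p i p' j|j _]; first exact: dhomog1.
  exact: dhomogM.
by rewrite -[X in ishomog1 X]mul1n; exact: dhomogMn.
Qed.

Section polynomial_forms.
Context {R : realType} {k : nat}.
Implicit Types (I : finType) (n : nat).

Definition mpoly_fun (p : mpoly k R) (x : 'rV[R]_k) : R :=
  meval (fun t => x 0 t) p.

Lemma barycentric_mpoly I (v : I -> 'rV[R]_k) : affinely_independent v ->
  exists2 beta : I -> mpoly k R, forall t, (msize (beta t) <= 2)%N &
    forall b, \sum_t b t = 1 ->
      forall t, mpoly_fun (beta t) (lincomb b v) = b t.
Proof.
move=> /barycentric_coordinates[beta [gamma coordE]].
exists (fun t => \sum_u beta t u *: mpolyX R (mnm1 u) + mpolyC k (gamma t)).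
  move=> t.
  apply: leq_trans (msizeD_le _ _) _.
  rewrite geq_max msizeC (leq_trans (leq_b1 _)) // andbT.
  apply: leq_trans (msize_sum _ _ _) _; apply/bigmax_leqP => u _.
  by rewrite (leq_trans (msizeZ_le _ _)) // msizeX mdeg1.
move=> b b1 t; rewrite [RHS](coordE b b1) /mpoly_fun mevalD mevalC raddf_sum.
by congr (_ + _); apply: eq_bigr => u _ /=; rewrite mevalZ mevalXU.
Qed.

Lemma bform_mpoly n I (w : I -> 'rV[R]_k) a : affinely_independent w ->
  exists2 p : mpoly k R, (msize p <= n.+1)%N & has_bform n w a (mpoly_fun p).
Proof.
move=> /barycentric_mpoly[beta beta2 betaE].
exists (\sum_(l | multi_index I n l)
    (a (entries l) * (n`!%:R / (\prod_t (entries l t)`!)%:R)) *: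
    \prod_t beta t ^+ entries l t).
  apply: leq_trans (msize_sum _ _ _) _; apply/bigmax_leqP => l /eqP ln.
  rewrite (leq_trans (msizeZ_le _ _)) // -[X in (_ <= X.+1)%N]ln.
  exact: msize_prod_exp_leq.
move=> b [_ b1]; rewrite /mpoly_fun /bform raddf_sum; apply: eq_bigr => l _ /=.
rewrite mevalZ -mulrA [meval _ _]rmorph_prod; congr (_ * (_ * _)).
apply: eq_bigr => t _.
by rewrite rmorphXn /= -[X in X ^+ _]/(mpoly_fun _ _) betaE.
Qed.

Lemma dhomog_bform n I (q : mpoly #|I| R) : q \is ishomog1 n mdeg ->
  exists a, forall b : I -> R, meval (b \o enum_val) q = bform n b a.
Proof.
move=> /dhomogP homq.
pose exps (m : multinom #|I|) (t : I) : nat := m (enum_rank t).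
have sum_exps m : m \in msupp q -> (\sum_t exps m t)%N = n.
  move=> /homq /= <-; rewrite mdegE big_enum_val; apply: eq_bigr => i _.
  by rewrite /exps enum_valK.
have entries_exps m : m \in msupp q -> entries (of_entries n (exps m)) = exps m.
  by move=> mq; apply: of_entries_sumK; rewrite sum_exps.
pose coeff l :=
  \sum_(m <- msupp q | (m \in msupp q) && (of_entries n (exps m) == l))
     mcoeff m q.
exists (fun l => coeff (of_entries n l) / (n`!%:R / (\prod_t (l t)`!)%:R)) => b.
rewrite mevalE big_seq.
rewrite (partition_big (of_entries n \o exps) (multi_index I n)) /=.
  apply: eq_bigr => l _; rewrite entriesK /bmonomial mulrA divfK; last first.
    by rewrite mulf_neq0 ?fact_neq0 // invr_neq0 ?prod_fact_neq0.
  rewrite mulr_suml; apply: eq_bigr => m /andP[mq /eqP <-]; congr (_ * _).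
  rewrite entries_exps // [RHS]big_enum_val; apply: eq_bigr => i _ /=.
  by rewrite /exps enum_valK.
move=> m mq; rewrite multi_indexE entries_exps //.
exact/eqP/sum_exps.
Qed.

(* Homogenise p by the sum of the barycentric coordinates, which is 1. *)
Lemma mpoly_bform n I (w : I -> 'rV[R]_k) (p : mpoly k R) :
  (msize p <= n.+1)%N -> exists a, has_bform n w a (mpoly_fun p).
Proof.
move=> size_p.
pose linear_form (c : I -> R) : mpoly #|I| R :=
  \sum_i c (enum_val i) *: mpolyX R (mnm1 i).
have linear_formE c (b : I -> R) :
    meval (b \o enum_val) (linear_form c) = \sum_t b t * c t.
  rewrite raddf_sum [RHS]big_enum_val; apply: eq_bigr => i _ /=.
  by rewrite mevalZ mevalXU mulrC.
pose q := \sum_(m <- msupp p) mcoeff m p *: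
  (linear_form (fun=> 1) ^+ (n - mdeg m) *
   \prod_u linear_form (fun t => w t 0 u) ^+ m u).
have [|a aE] := @dhomog_bform n I q.
  rewrite /q big_seq; apply: rpred_sum => m mp; apply: dhomogZ.
  have mn : (mdeg m <= n)%N.
    by rewrite -ltnS (leq_trans _ size_p) // msize_mdeg_lt.
  rewrite -[X in ishomog1 X](subnK mn); apply: dhomogM.
    by rewrite -[X in ishomog1 X]mul1n; apply/dhomogMn/dhomog_linear_form.
  by rewrite mdegE; apply: dhomog_prod_exp => u; exact: dhomog_linear_form.
exists a => b [_ b1]; rewrite -aE /mpoly_fun mevalE raddf_sum.
apply: eq_bigr => m _ /=.
rewrite mevalZ mevalM rmorphXn rmorph_prod /= linear_formE.
under [\sum_t b t * 1]eq_bigr do rewrite mulr1.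
rewrite b1 expr1n mul1r; congr (_ * _); apply: eq_bigr => u _.
rewrite rmorphXn /= linear_formE summxE; congr (_ ^+ _).
by apply: eq_bigr => t _; rewrite mxE.
Qed.

End polynomial_forms.

(** * Determining sets *)

Lemma fset_set_val (T : choiceType) (A : set T) (t : fset_set A) :
  finite_set A -> A (val t).
Proof. by move=> finA; have := valP t; rewrite in_fset_set // => /set_mem. Qed.

Section determining_sets.
Context {R : numFieldType} {T : choiceType}.
Implicit Types (D M N A : set T) (W : set (T -> R)) (c : T -> R).

Definition function_subspace W : Prop :=
  W 0 /\ forall s c c', W c -> W c' -> W (s *: c + c').

Definition vanishes_on A c : Prop := forall p, A p -> c p = 0.

Definition determines D W M : Prop :=
  M `<=` D /\ forall c, W c -> vanishes_on M c -> vanishes_on D c.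

Definition minimally_determines D W M : Prop :=
  determines D W M /\ forall N, determines D W N -> (M #<= N)%card.

Definition has_dual_family W M : Prop := forall p, M p ->
  exists c, [/\ W c, c p = 1 & vanishes_on (M `\ p) c].

Lemma function_subspace_sum W (I : Type) (r : seq I) (a : I -> R)
    (c : I -> T -> R) :
  function_subspace W -> (forall i, W (c i)) -> W (\sum_(i <- r) a i *: c i).
Proof.
move=> [W0 Wlin] Wc; elim: r => [|i r IHr]; first by rewrite big_nil.
by rewrite big_cons; exact: Wlin.
Qed.

Variables (D : set T) (W : set (T -> R)).
Hypothesis finD : finite_set D.
Hypothesis subW : function_subspace W.

Lemma determines_finite M : determines D W M -> finite_set M.
Proof. by move=> [MD _]; exact: sub_finite_set MD finD. Qed.

Lemma minimally_determines_dual M :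
  minimally_determines D W M -> has_dual_family W M.
Proof.
move=> [detM minM] p Mp; have [MD detM0] := detM.
have finM := determines_finite detM.
have [c [Wc cM cp]] : exists c, [/\ W c, vanishes_on (M `\ p) c & c p <> 0].
  apply: contrapT => noc; have /minM leM : determines D W (M `\ p).
    split=> [q [/MD //]|c Wc cMp]; apply: detM0 => // q Mq.
    have [->|qp] := pselect (q = p); last exact: cMp.
    by apply: contrapT => cp; apply: noc; exists c.
  have [n Mn] := (finite_setP M).1 finM.
  have := @leq_card_fset_set _ (M `\ p) n.
  rewrite -(card_le_eql Mn) => /(_ (finite_setD _ finM) leM).
  rewrite fset_setD1 // -(card_fset_set Mn) (cardfsD1 p (fset_set M)).
  by rewrite in_fset_set // mem_set // add1n ltnn.
exists ((c p)^-1 *: c + 0); split.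
- by case: subW => W0 Wlin; exact: Wlin.
- by rewrite addr0 -[LHS]/(_ * _) mulVf //; exact/eqP.
- by move=> q /cM cq; rewrite addr0 -[LHS]/(_ * c q) cq mulr0.
Qed.

Lemma dual_functions M : finite_set M -> has_dual_family W M ->
  exists dual : fset_set M -> T -> R, (forall t, W (dual t)) /\
    forall a t, (\sum_t a t *: dual t) (val t) = a t.
Proof.
move=> finM dualM.
have /choice[dual dualP] t := dualM _ (fset_set_val t finM).
exists dual; split=> [t|a t]; first by have [] := dualP t.
rewrite fct_sumE (big_only1 t) // => [|t' t't _].
  by rewrite -[LHS]/(_ * _); have [_ -> _] := dualP t; rewrite mulr1.
rewrite -[LHS]/(_ * _); have [_ _ ->] := dualP t'; rewrite ?mulr0 //.
split=> [|/val_inj tt']; first exact: (fset_set_val t finM).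
by rewrite tt' eqxx in t't.
Qed.

(* Evaluation at the points of N embeds the span of the dual functions of M. *)
Lemma dual_minimally_determines M :
  determines D W M -> has_dual_family W M -> minimally_determines D W M.
Proof.
move=> detM dualM; split=> // N detN; have [MD _] := detM.
have [finM finN] := (determines_finite detM, determines_finite detN).
have [dual [Wdual dual_eval]] := dual_functions finM dualM.
have leMN : (#|` fset_set M| <= #|` fset_set N|)%N.
  rewrite !cardfE; apply: (@linearly_independent_card _ _ _
    (fun t => \row_j dual t (val (enum_val j)))) => a a0 t.
  rewrite -[LHS]dual_eval; have [_ ->] // := detN.
  - exact: function_subspace_sum.
  - move=> q Nq; have qN : q \in fset_set N by rewrite in_fset_set // mem_set.
    have /rowP/(_ (enum_rank [` qN]%fset)) := a0; rewrite summxE mxE => <-.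
    by rewrite fct_sumE; apply: eq_bigr => u _; rewrite !mxE enum_rankK.
  exact: (MD _ (fset_set_val t finM)).
have [[m Mm] [n Nn]] := ((finite_setP M).1 finM, (finite_setP N).1 finN).
rewrite (card_le_eql Mm) (card_le_eqr Nn) card_le_II.
by rewrite -(card_fset_set Mm) -(card_fset_set Nn).
Qed.

End determining_sets.

Section disjoint_union.
Context {R : numFieldType} {J : finType} {U T : choiceType}.
Variable phi : J -> U -> T.

Definition glue (A : J -> set U) : set T := \bigcup_j (phi j @` A j).

Lemma card_glue (M : J -> set U) :
  (forall j j' p p', M j p -> M j' p' ->
     phi j p = phi j' p' -> j = j' /\ p = p') ->
  (forall j, finite_set (M j)) ->
  #|` fset_set (glue M)| = (\sum_j #|` fset_set (M j)|)%N.
Proof.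
move=> phi_inj finM; pose tagged_point := {j : J & fset_set (M j)}.
pose e (x : tagged_point) := phi (tag x) (val (tagged x)).
have M_tagged (x : tagged_point) : M (tag x) (val (tagged x)).
  exact: (fset_set_val (tagged x) (finM _)).
have inj_e : injective e.
  move=> x x' ee; have [] := phi_inj _ _ _ _ (M_tagged x) (M_tagged x') ee.
  move: x x' {ee} => [j p] [j' p'] /= jj'.
  by move: p p'; rewrite -jj' => p p' /val_inj ->.
have fin_glue : finite_set (glue M).
  by apply: bigcup_finite => // j _; exact: finite_image.
have -> : fset_set (glue M) = [fset e x | x in {: tagged_point}]%fset.
  apply/fsetP => y; rewrite in_fset_set //; apply/idP/imfsetP => [|[x _ ->]].
    move=> /set_mem[j _ [p Mp <-]]; have pM : p \in fset_set (M j).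
      by rewrite in_fset_set // mem_set.
    by exists (Tagged (fun j => fset_set (M j)) [` pM]%fset).
  by rewrite mem_set //; exists (tag x) => //; exists (val (tagged x)).
rewrite card_imfset //= -cardE card_tagged sumnE big_map big_enum.
by apply: eq_bigr => j _; rewrite cardfE.
Qed.

Variables (D : J -> set U) (W : J -> set (U -> R)) (W' : set (T -> R)).
Hypothesis finD : forall j, finite_set (D j).
Hypothesis subW : forall j, function_subspace (W j).
Hypothesis subW' : function_subspace W'.
Hypothesis restrictW : forall j c, W' c -> W j (c \o phi j).
Hypothesis extendW : forall j c, W j c -> exists2 c', W' c' &
  forall j' p, D j' p -> c' (phi j' p) = if j' == j then c p else 0.

Lemma glue_minimally_determines (M : J -> set U) :
  (forall j, minimally_determines (D j) (W j) (M j)) ->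
  minimally_determines (glue D) W' (glue M).
Proof.
move=> minM; have MD j : M j `<=` D j by have [[]] := minM j.
apply: dual_minimally_determines => //.
- by apply: bigcup_finite => // j _; exact: finite_image.
- split=> [|c W'c cM _ [j _ [p Dp <-]]].
    by apply: subset_bigcup => j _; exact: image_subset.
  have [[_ detM] _] := minM j.
  apply: (detM (c \o phi j)) => //; first exact: restrictW.
  by move=> q Mq; apply: cM; exists j => //; exists q.
- move=> _ [j _ [p Mp <-]].
  have [c [Wc cp cM]] :=
    minimally_determines_dual (finD j) (subW j) (minM j) Mp.
  have [c' W'c' c'E] := extendW Wc; exists c'; split=> //.
    by rewrite c'E ?eqxx //; exact: MD.
  move=> _ [[j' _ [q Mq <-]]]; rewrite c'E; last exact: MD.
  case: eqP => // jj'; rewrite jj' in Mq *; move=> qp; apply: cM; split=> //.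
  by move=> qp'; apply: qp; rewrite qp'.
Qed.

End disjoint_union.

(** * Splines and their Bernstein-Bezier coefficients *)

Section lattice_points.
Context {R : realType} {V : lmodType R}.
Implicit Types (I J : finType) (q : R) (n : nat).

Definition lattice_point q I (w : I -> V) (l : I -> nat) : V :=
  lincomb (fun t => q * (l t)%:R) w.

Definition lattice_points n q I (w : I -> V) : set V :=
  [set lattice_point q w l | l in [set l | (\sum_t l t)%N = n]].

Lemma lattice_point_extend I J (h : I -> J) q (w : J -> V) l : injective h ->
  lattice_point q w (extend 0%N h l) = lattice_point q (w \o h) l.
Proof.
move=> injh; rewrite /lattice_point -(lincomb_extend _ _ injh); congr lincomb.
by apply/funext => j; rewrite (map_extend (fun x => q * x%:R)) mulr0.
Qed.

Lemma lattice_point_scale q s I (w : I -> V) l :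
  lattice_point q (fun t => s *: w t) l = lattice_point (q * s) w l.
Proof. by apply: eq_bigr => t _; rewrite scalerA mulrAC. Qed.

Lemma lattice_point_case_sum I J q (w : I -> V) (w' : J -> V) l l' :
  lattice_point q (case_sum w w') (case_sum l l') =
  lattice_point q w l + lattice_point q w' l'.
Proof. exact: lincomb_case_sum. Qed.

Lemma lattice_point0 q I (w : I -> V) : lattice_point q w (fun=> 0%N) = 0.
Proof.
by rewrite /lattice_point; under eq_fun do rewrite mulr0; exact: lincomb0.
Qed.

Lemma lattice_points0 q I (w : I -> V) : lattice_points 0 q w = [set 0].
Proof.
apply/seteqP; split=> [_ [l l0 <-]|_ ->] /=.
  rewrite (_ : l = fun=> 0%N) ?lattice_point0 //; apply/funext => t.
  by apply/eqP; rewrite -leqn0 -l0 leq_sum_entry.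
by exists (fun=> 0%N); [rewrite /= big1|rewrite lattice_point0].
Qed.

Lemma lattice_point_inj I (w : I -> V) d : linearly_independent w ->
  injective
    (fun l : {ffun I -> 'I_d.+1} => lattice_point d%:R^-1 w (entries l)).
Proof.
move=> freew l l' ll'; rewrite -[l]entriesK -[l']entriesK; congr of_entries.
apply/funext => t; have [d0|d_gt0] := posnP d.
  have zero (l1 : {ffun I -> 'I_d.+1}) : entries l1 t = 0%N.
    by apply/eqP; rewrite -leqn0 -[X in (_ <= X)%N]d0 entries_leq.
  by rewrite !zero.
have := lincomb_inj freew ll' t; move/(mulfI _).
rewrite invr_eq0 pnatr_eq0 -lt0n d_gt0 => /(_ isT)/eqP.
by rewrite eqr_nat => /eqP.
Qed.

Lemma lattice_points_extend I J (h : I -> J) n q (w : J -> V) : injective h ->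
  lattice_points n q (w \o h) `<=` lattice_points n q w.
Proof.
move=> injh _ [l ln <-].
exists (extend 0%N h l); last exact: lattice_point_extend.
by rewrite /= (big_extend injh (F := fun _ x => x)).
Qed.

Lemma lattice_points_bij I J (h : I -> J) n q (w : J -> V) : bijective h ->
  lattice_points n q w = lattice_points n q (w \o h).
Proof.
move=> bijh; apply/seteqP; split; last exact/lattice_points_extend/bij_inj.
have [h' hK h'K] := bijh; rewrite {1}(_ : w = (w \o h) \o h').
  exact/lattice_points_extend/can_inj.
by apply/funext => j /=; rewrite h'K.
Qed.

Lemma lattice_points_case_sum I J n q (w : I -> V) (w' : J -> V) p :
  lattice_points n q (case_sum w w') p <->
  exists2 j : {ffun J -> 'I_n.+1}, (\sum_t j t <= n)%N &
    exists2 p0, lattice_points (n - \sum_t j t) q w p0 &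
      p = p0 + lattice_point q w' (entries j).
Proof.
split=> [[l ln <-]|[j jn [_ [l ln <-] ->]]].
  have lE : l = case_sum (l \o inl) (l \o inr) by apply/funext => -[].
  have inlE : (\sum_t (l \o inl) t + \sum_t (l \o inr) t)%N = n.
    by rewrite -ln big_sumType.
  have inrK : entries (of_entries n (l \o inr)) = l \o inr.
    by apply: of_entries_sumK; rewrite -inlE leq_addl.
  exists (of_entries n (l \o inr)); rewrite -/(\sum_t entries _ t)%N inrK.
    by rewrite -inlE leq_addl.
  exists (lattice_point q w (l \o inl)); last first.
    by rewrite -lattice_point_case_sum -lE.
  by exists (l \o inl) => //=; rewrite -[in RHS]inlE addnK.
exists (case_sum l (entries j)); last exact: lattice_point_case_sum.
by rewrite /= big_sumType /= ln subnK.
Qed.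

Lemma lattice_points_finite n q I (w : I -> V) :
  finite_set (lattice_points n q w).
Proof.
pose point (l : {ffun I -> 'I_n.+1}) := lattice_point q w (entries l).
apply: (@sub_finite_set _ _ (range point)) => [_ [l ln <-]|].
  by exists (of_entries n l); rewrite // /point of_entries_sumK ?ln.
exact/finite_image/finite_finset.
Qed.

End lattice_points.

Section coefficient_spaces.
Context {R : realType} {k : nat}.
Local Notation E := 'rV[R]_k.
Local Notation verts s := (@vertices R k s).
Implicit Types (K : set {fset E}) (s : {fset E}) (r d n : nat) (q : R).
Implicit Types (g c : E -> R).

Lemma sub_maximal_simplex K s : finite_set K -> K s ->
  exists2 s', maximal_simplex K s' & (s `<=` s')%fset.
Proof.
move=> finK Ks; pose X := fset_set K.
have KX s' : (s' \in X) = (s' \in K) by rewrite in_fset_set.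
have sX : s \in X by rewrite KX mem_set.
case: (@arg_maxnP X [` sX]%fset (fun x => s `<=` val x)%fset
  (fun x => #|` val x|)) => [//|s' ss' s'max].
exists (val s') => //; split=> [|s'' Ks'' s's''].
  by apply/set_mem; rewrite -KX; exact: valP.
apply/eqP; rewrite eq_sym -(geq_leqif (fsubset_leqif_cards s's'')).
have s''X : s'' \in X by rewrite KX mem_set.
by apply: (s'max [` s''X]%fset) => /=; exact: fsubset_trans s's''.
Qed.

Lemma domain_pointE (I : finType) d (w : I -> E) (l : {ffun I -> 'I_d.+1}) :
  domain_point w l = lattice_point d%:R^-1 w (entries l).
Proof. by rewrite /domain_point /lattice_point lincombZ. Qed.

Lemma domain_pointsE K d :
  domain_points K d = \bigcup_(s in K) lattice_points d d%:R^-1 (verts s).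
Proof.
apply: eq_bigcupr => s _; apply/seteqP; split=> [_ [l /eqP ld <-]|_ [l ld <-]].
  by exists (entries l); rewrite ?domain_pointE.
exists (of_entries d l); last by rewrite domain_pointE of_entries_sumK ?ld.
by rewrite /= multi_indexE of_entries_sumK ld.
Qed.

Lemma lattice_points_maximal K n q : finite_set K ->
  \bigcup_(s in K) lattice_points n q (verts s) =
  \bigcup_(s in maximal_simplex K) lattice_points n q (verts s).
Proof.
move=> finK; apply/seteqP; split=> p [s].
  move=> Ks sp; have [s' ms' ss'] := sub_maximal_simplex finK Ks.
  exists s' => //; exact: (lattice_points_extend (@fincl_inj _ _ _ ss')) sp.
by move=> [Ks _] sp; exists s.
Qed.

Lemma domain_points_finite K d : finite_set K -> finite_set (domain_points K d).
Proof.
move=> finK; rewrite domain_pointsE.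
by apply: bigcup_finite => // s _; exact: lattice_points_finite.
Qed.

Lemma conv_hull_vertex (I : finType) (w : I -> E) i : conv_hull w (w i).
Proof.
exists (fun t => (t == i)%:R); first exact: delta_weight.
by rewrite -/(lincomb _ _) lincomb_delta.
Qed.

Lemma simplex_polyhedron K s (b : s -> R) : K s -> is_weight b ->
  exists x : polyhedron K, val x = lincomb b (verts s).
Proof.
move=> Ks wb; have xK : lincomb b (verts s) \in polyhedron K.
  by apply/mem_set; exists s => //; exists b.
by exists (exist (fun y => y \in polyhedron K) _ xK).
Qed.

Lemma polyhedron_maximal K x : finite_set K -> polyhedron K x ->
  exists2 s, maximal_simplex K s & conv_hull (verts s) x.
Proof.
move=> finK [s Ks [b wb ->]].
have [s' ms' ss'] := sub_maximal_simplex finK Ks; exists s' => //.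
have injh := @fincl_inj _ _ _ ss'; exists (extend 0 (fincl ss') b).
  exact: extend_weight.
by rewrite -/(lincomb _ _) -/(lincomb _ _) lincomb_extend.
Qed.

Definition piecewise_bform K n q g c : Prop := forall s, maximal_simplex K s ->
  has_bform n (verts s) (c \o lattice_point q (verts s)) g.

Definition form_space K r n q : set (E -> R) :=
  [set c | exists2 g, Cr_function r g & piecewise_bform K n q g c].

Lemma piecewise_bformP K n q a g c g' c' : piecewise_bform K n q g c ->
  piecewise_bform K n q g' c' ->
  piecewise_bform K n q (a *: g + g') (a *: c + c').
Proof. by move=> gc g'c' s ms; apply: has_bformP; [exact: gc|exact: g'c']. Qed.

Lemma piecewise_bform_sum K n q (I : Type) (r : seq I) (a : I -> R)
    (g c : I -> E -> R) :
  (forall i, piecewise_bform K n q (g i) (c i)) ->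
  piecewise_bform K n q (\sum_(i <- r) a i *: g i) (\sum_(i <- r) a i *: c i).
Proof.
move=> gc; elim: r => [|i r IHr].
  by rewrite !big_nil => s _; exact: has_bform0.
by rewrite !big_cons; exact: piecewise_bformP.
Qed.

Lemma form_space_subspace K r n q : function_subspace (form_space K r n q).
Proof.
split; first by exists 0; [exact: Cr_cst|move=> s _; exact: has_bform0].
move=> a c c' [g Cg gc] [g' Cg' g'c']; exists (a *: g + g').
  by apply: CrD => //; exact: CrZ.
exact: piecewise_bformP.
Qed.

Lemma form_space_deg0 K r q c : form_space K r 0 q c.
Proof.
exists (fun=> c 0); first exact: Cr_cst.
move=> s _ b _; rewrite bform_deg0 /=; congr c.
by rewrite lattice_point0.
Qed.

Lemma BB_coefficientsP K d g c :
  @BB_coefficients R k K d (fun x => g (val x)) c <->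
  piecewise_bform K d d%:R^-1 g c.
Proof.
split=> gc s ms b wb => [|x xE].
  have [x xE] := simplex_polyhedron (proj1 ms) wb.
  rewrite -xE (gc s ms b wb x xE); apply: eq_bigr => l _.
  by rewrite domain_pointE.
rewrite xE (gc s ms b wb); apply: eq_bigr => l _.
by rewrite domain_pointE.
Qed.

End coefficient_spaces.

Section spline_determining_sets.
Context {R : realType} {k : nat}.
Local Notation E := 'rV[R]_k.
Local Notation verts s := (@vertices R k s).
Implicit Types (s : {fset E}) (g c : E -> R) (M : set E).
Variables (K : set {fset E}) (r d : nat).

Definition coefficient_space : set (E -> R) := form_space K r d d%:R^-1.

Hypothesis finK : finite_set K.
Hypothesis neK : forall s, maximal_simplex K s -> s != fset0.
Hypothesis affK :
  forall s, maximal_simplex K s -> affinely_independent (verts s).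

Let D := domain_points K d.
Let finD : finite_set D := domain_points_finite d finK.
Let subW : function_subspace coefficient_space :=
  form_space_subspace K r d d%:R^-1.

Lemma piecewise_bform_eq0 g c : piecewise_bform K d d%:R^-1 g c ->
  (forall x : polyhedron K, g (val x) = 0) <-> vanishes_on D c.
Proof.
rewrite /D domain_pointsE lattice_points_maximal // => gc.
split=> [g0 _ [s ms [l ld <-]]|c0 x].
  have /fset0Pn[w ws] := neK ms.
  apply: (bform_eq0 [` ws]%fset (a := c \o lattice_point d%:R^-1 (verts s))) ld.
  move=> b wb; rewrite -(gc s ms b wb).
  by have [x <-] := simplex_polyhedron (proj1 ms) wb.
have [s ms [b wb ->]] := polyhedron_maximal finK (set_mem (valP x)).
rewrite (gc s ms b wb) -(linear0 (bform d b)); apply: eq_bform => l ld.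
by apply: c0; exists s => //; exists l.
Qed.

Lemma piecewise_bform_spline g c : Cr_function r g ->
  piecewise_bform K d d%:R^-1 g c -> spline_space K r d (fun x => g (val x)).
Proof.
move=> Cg gc; split=> [|s ms]; first by exists g.
have [p size_p pE] :=
  bform_mpoly d (c \o lattice_point d%:R^-1 (verts s)) (affK ms).
by exists p => // x [b wb ->]; rewrite (gc s ms b wb) -(pE b wb).
Qed.

Lemma spline_coefficients f c : spline_space K r d f -> BB_coefficients d f c ->
  exists g, [/\ Cr_function r g, f = (fun x => g (val x)) &
    piecewise_bform K d d%:R^-1 g c].
Proof.
move=> [[g Cg /funext fg] _]; rewrite fg => /BB_coefficientsP gc.
by exists g.
Qed.

Lemma determining_setP M : determining_set d (spline_space K r d) M <->
  determines D coefficient_space M.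
Proof.
split=> -[MD detM]; split=> //.
  move=> c [g Cg gc] cM; apply/(piecewise_bform_eq0 gc).
  apply: detM cM; last exact/BB_coefficientsP.
  exact: piecewise_bform_spline gc.
move=> f c Sf fc cM; have [g [Cg -> gc]] := spline_coefficients Sf fc.
by apply/(piecewise_bform_eq0 gc); apply: detM cM; exists g.
Qed.

Lemma minimal_determining_setP M :
  minimal_determining_set d (spline_space K r d) M <->
  minimally_determines D coefficient_space M.
Proof.
by split=> -[/determining_setP detM minM]; split=> // N /determining_setP;
  exact: minM.
Qed.

Lemma spline_space_dim M :
  (forall f, spline_space K r d f -> exists c, BB_coefficients d f c) ->
  minimal_determining_set d (spline_space K r d) M ->
  has_dim (spline_space K r d) #|` fset_set M|.
Proof.
move=> BBex /minimal_determining_setP minM; have [[MD detM] _] := minM.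
have finM := determines_finite finD minM.1.
have [dual [Wdual dualM]] :=
  dual_functions finM (minimally_determines_dual finD subW minM).
have /choice[g gP] t :
    exists g, Cr_function r g /\ piecewise_bform K d d%:R^-1 g (dual t).
  by have [g] := Wdual t; exists g.
pose comb (h : fset_set M -> E -> R) (a : 'I_#|{: fset_set M}| -> R) :=
  \sum_t a (enum_rank t) *: h t.
have combE a x : comb g a x = \sum_i a i * g (enum_val i) x.
  rewrite /comb fct_sumE big_enum_val; apply: eq_bigr => i _.
  by rewrite enum_valK.
have combM a t : comb dual a (val t) = a (enum_rank t) by exact: dualM.
have comb_form a : piecewise_bform K d d%:R^-1 (comb g a) (comb dual a).
  by apply: piecewise_bform_sum => t; have [] := gP t.
rewrite cardfE; exists (fun i x => g (enum_val i) (val x)).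
split=> [i|a a0 i|f Sf].
- by have [Cg gc] := gP (enum_val i); exact: piecewise_bform_spline gc.
- have comb0 (x : polyhedron K) : comb g a (val x) = 0 by rewrite combE.
  have Di : D (val (enum_val i)) := MD _ (fset_set_val (enum_val i) finM).
  have := (piecewise_bform_eq0 (comb_form a)).1 comb0 _ Di.
  by rewrite combM enum_valK.
- have [c fc] := BBex f Sf; have [g0 [Cg0 fE gc0]] := spline_coefficients Sf fc.
  pose a (i : 'I_#|{: fset_set M}|) := c (val (enum_val i)).
  exists a => x; rewrite -combE fE.
  have diff_form := piecewise_bformP (-1) (comb_form a) gc0.
  apply/eqP; rewrite -subr_eq0 addrC -mulN1r; apply/eqP.
  apply: (piecewise_bform_eq0 diff_form).2; apply: detM => [|p Mp].
    have [_ linW] := subW.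
    by apply: linW; [exact: function_subspace_sum|exists g0].
  have pM : p \in fset_set M by rewrite in_fset_set // mem_set.
  rewrite -[LHS]/(-1 * comb dual a (val [` pM]%fset) + c p) combM /a enum_rankK.
  by rewrite mulN1r addNr.
Qed.

End spline_determining_sets.

Section face_to_face.
Context {R : realType} {k : nat}.
Local Notation E := 'rV[R]_k.
Local Notation verts s := (@vertices R k s).
Implicit Types (K : set {fset E}) (Z s : {fset E}) (n d : nat) (g : E -> R).

Lemma affinely_independent_bij (I J : finType) (h : I -> J) (w : J -> E) :
  bijective h -> affinely_independent (w \o h) -> affinely_independent w.
Proof.
move=> bijh affw b b1 b0 j; have [h' _ h'K] := bijh; rewrite -(h'K j).
apply: (affw (b \o h)); last by rewrite -/(lincomb _ _) -lincomb_bij.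
by apply: etrans b1; rewrite [RHS](reindex h) //; exact: onW_bij.
Qed.

Lemma affine_coordinates_inj (I : finType) (w : I -> E) (b b' : I -> R) :
  affinely_independent w -> \sum_t b t = \sum_t b' t ->
  lincomb b w = lincomb b' w -> b = b'.
Proof.
move=> affw bb' wbb'; apply/funext => t.
apply/eqP; rewrite -subr_eq0; apply/eqP.
apply: (affw (fun t => b t - b' t)); first by rewrite sumrB bb' subrr.
by rewrite -/(lincomb _ _) lincombB wbb' subrr.
Qed.

(* Maximal simplices meet in common faces, by their barycentric coordinates. *)
Definition face_to_face K : Prop := forall s s',
  maximal_simplex K s -> maximal_simplex K s' ->
  forall (b : s -> R) (b' : s' -> R), is_weight b -> is_weight b' ->
  lincomb b (verts s) = lincomb b' (verts s') ->
  extend 0 (verts s) b = extend 0 (verts s') b'.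

Lemma extend_subface Z s (Zs : (Z `<=` s)%fset) (b : s -> R) (bZ : Z -> R) :
  affinely_independent (verts s) -> is_weight b -> is_weight bZ ->
  lincomb b (verts s) = lincomb bZ (verts Z) ->
  extend 0 (verts s) b = extend 0 (verts Z) bZ.
Proof.
move=> affs [_ b1] wbZ bbZ; have injh := @fincl_inj _ _ _ Zs.
have -> : b = extend 0 (fincl Zs) bZ.
  apply: (affine_coordinates_inj affs); last by rewrite bbZ lincomb_extend.
  by have [_ ->] := extend_weight injh wbZ.
by rewrite extend_comp //; exact: val_inj.
Qed.

Lemma complex_face_to_face K : simplicial_complex K -> face_to_face K.
Proof.
move=> Kc s s' [Ks _] [Ks' _] b b' wb wb' bb'.
have : (conv_hull (verts s) `&` conv_hull (verts s'))
    (lincomb b (verts s)) by split; [exists b|exists b'].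
rewrite (complex_cap Kc Ks Ks') => -[bZ wbZ bE].
rewrite (extend_subface (fsubsetIl s s') (complex_affine Kc Ks) wb wbZ bE).
by rewrite (extend_subface (fsubsetIr s s') (complex_affine Kc Ks') wb' wbZ)
  -?bb'.
Qed.

Lemma face_to_face_cone K s s' (b : s -> R) (b' : s' -> R) : face_to_face K ->
  maximal_simplex K s -> maximal_simplex K s' ->
  (forall t, 0 <= b t) -> (forall t, 0 <= b' t) -> \sum_t b t = \sum_t b' t ->
  lincomb b (verts s) = lincomb b' (verts s') ->
  extend 0 (verts s) b = extend 0 (verts s') b'.
Proof.
move=> ffK ms ms' b0 b'0 massE bb'; set u := \sum_t b t in massE.
have u_ge0 : 0 <= u by apply: sumr_ge0.
have [u0|u_neq0] := eqVneq u 0.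
  have zero s1 (b1 : s1 -> R) : (forall t, 0 <= b1 t) -> \sum_t b1 t = 0 ->
      extend 0 (verts s1) b1 = fun=> 0.
    move=> b10 /psumr_eq0P b1E; apply/funext => z; rewrite /extend.
    by case: pickP => // t _; apply: b1E.
  by rewrite !zero // -massE.
have u_gt0 : 0 < u by rewrite lt_neqAle eq_sym u_neq0.
have normalized s1 (b1 : s1 -> R) : (forall t, 0 <= b1 t) -> \sum_t b1 t = u ->
    is_weight (fun t => u^-1 * b1 t).
  by move=> b10 b1u; rewrite -b1u; apply: normalized_weight; rewrite ?b1u.
have scaled s1 (b1 : s1 -> R) : extend 0 (verts s1) b1 =
    fun z => u * extend 0 (verts s1) (fun t => u^-1 * b1 t) z.
  apply/funext => z; rewrite (map_extend (fun x => u * x)) mulr0; congr extend.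
  by apply/funext => t /=; rewrite mulVKf.
rewrite scaled [RHS]scaled (ffK _ _ ms ms' _ _ (normalized _ _ b0 erefl)
  (normalized _ _ b'0 (esym massE))) //.
by rewrite !lincombZ bb'.
Qed.

Lemma restrict_common_face s s' Z (Zs : (Z `<=` s)%fset) (l : s -> nat)
    (l' : s' -> nat) :
  (s `&` s' `<=` Z)%fset ->
  extend 0%N (verts s) l = extend 0%N (verts s') l' ->
  extend 0%N (fincl Zs) (l \o fincl Zs) = l.
Proof.
move=> capZ ll'; apply: extend_restrict => w wZ.
rewrite -[l w](extendE 0%N l w (@val_inj _ _ s)) -/(verts s) ll'.
apply: extend_notin; apply: contra wZ => /codomP[w' ww'].
have wZ : val w \in Z.
  by apply: (fsubsetP capZ); rewrite in_fsetI (valP w) [val w]ww' (valP w').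
by apply/codomP; exists [` wZ]%fset; exact: val_inj.
Qed.

Lemma bform_common_face s s' n a a' g (z0 : E) (l : s -> nat) (l' : s' -> nat) :
  z0 \in s -> z0 \in s' ->
  has_bform n (verts s) a g -> has_bform n (verts s') a' g ->
  (\sum_t l t)%N = n ->
  extend 0%N (verts s) l = extend 0%N (verts s') l' ->
  a l = a' l'.
Proof.
move=> z0s z0s' ag a'g ln ll'; pose Z := (s `&` s')%fset.
have z0Z : z0 \in Z by rewrite in_fsetI z0s.
pose h := fincl (fsubsetIl s s'); pose h' := fincl (fsubsetIr s s').
have [injh injh'] : injective h /\ injective h' by split; exact: fincl_inj.
have lE : extend 0%N h (l \o h) = l.
  exact: restrict_common_face (fsubset_refl _) ll'.
have hh' : l \o h = l' \o h'.
  apply/funext => z /=; rewrite -(extendE 0%N l (h z) (@val_inj _ _ s)).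
  rewrite -(extendE 0%N l' (h' z) (@val_inj _ _ s')).
  by move: ll' => /(congr1 (fun f : E -> nat => f (val z))).
have l'E : extend 0%N h' (l \o h) = l'.
  by rewrite hh'; apply: restrict_common_face (esym ll'); rewrite fsetIC.
rewrite -lE -[in RHS]l'E.
apply: (bform_unique [` z0Z]%fset (w := verts Z)
  (has_bform_extend injh ag) (has_bform_extend injh' a'g)).
by rewrite -ln -[in RHS]lE (big_extend injh (F := fun _ x => x)).
Qed.

Lemma lattice_point_face_to_face K d s s' (l : s -> nat) (l' : s' -> nat) :
  face_to_face K -> maximal_simplex K s -> maximal_simplex K s' ->
  (\sum_t l t)%N = d -> (\sum_t l' t)%N = d ->
  lattice_point d%:R^-1 (verts s) l = lattice_point d%:R^-1 (verts s') l' ->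
  extend 0%N (verts s) l = extend 0%N (verts s') l'.
Proof.
move=> ffK ms ms' ld l'd ll'; apply/funext => z; have [d0|d_gt0] := posnP d.
  have zero s1 (l1 : s1 -> nat) :
      (\sum_t l1 t)%N = d -> extend 0%N (verts s1) l1 z = 0%N.
    move=> l1d; rewrite /extend; case: pickP => // t _; apply/eqP.
    by rewrite -leqn0 -d0 -l1d leq_sum_entry.
  by rewrite !zero.
have d_neq0 : d%:R^-1 != 0 :> R by rewrite invr_eq0 pnatr_eq0 -lt0n.
have weight s1 (l1 : s1 -> nat) :
    (\sum_t l1 t)%N = d -> is_weight (fun t => d%:R^-1 * (l1 t)%:R : R).
  move=> l1d; rewrite -l1d natr_sum; apply: normalized_weight => //.
  by rewrite -natr_sum ltr0n l1d.
have := ffK s s' ms ms' _ _ (weight _ _ ld) (weight _ _ l'd) ll'.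
have scaled s1 (l1 : s1 -> nat) :
    extend 0 (verts s1) (fun t => d%:R^-1 * (l1 t)%:R) z =
    d%:R^-1 * (extend 0%N (verts s1) l1 z)%:R.
  by rewrite (map_extend (fun x => d%:R^-1 * x%:R)) mulr0.
move=> /(congr1 (fun f : E -> R => f z)).
rewrite !scaled => /(mulfI d_neq0)/eqP.
by rewrite eqr_nat => /eqP.
Qed.

Lemma piecewise_bform_exists K d g : face_to_face K ->
  (forall s, maximal_simplex K s -> 0 \in s) ->
  (forall s, maximal_simplex K s -> exists a, has_bform d (verts s) a g) ->
  exists c, piecewise_bform K d d%:R^-1 g c.
Proof.
move=> ffK K0 ga.
pose coeff_at z := [set y : R | exists s (a : (s -> nat) -> R) (l : s -> nat),
  [/\ maximal_simplex K s, has_bform d (verts s) a g, (\sum_t l t)%N = d,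
      z = lattice_point d%:R^-1 (verts s) l & y = a l]].
exists (fun z => xget 0 (coeff_at z)) => s ms b wb.
have [a ag] := ga s ms; rewrite (ag b wb); apply: eq_bform => l ld /=.
have /(xgetPex 0) : exists y, coeff_at (lattice_point d%:R^-1 (verts s) l) y.
  by exists (a l), s, a, l.
move=> [s' [a' [l' [ms' a'g l'd pointE ->]]]].
apply: (bform_common_face (K0 s ms) (K0 s' ms') ag a'g ld).
exact: (lattice_point_face_to_face ffK ms ms' ld l'd pointE).
Qed.

Lemma spline_coefficients_exist K r d f : face_to_face K ->
  (forall s, maximal_simplex K s -> 0 \in s) ->
  spline_space K r d f -> exists c, BB_coefficients d f c.
Proof.
move=> ffK K0 [[g _ /funext fg] fpoly].
have [s ms|c gc] := piecewise_bform_exists ffK K0 (d := d) (g := g).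
  have [p size_p fp] := fpoly s ms.
  have [a pa] := mpoly_bform (verts s) size_p.
  exists a => b wb; rewrite -(pa b wb).
  have [x xE] := simplex_polyhedron (proj1 ms) wb.
  by have := fp x; rewrite fg xE; apply; exists b.
by exists c; rewrite fg; exact/BB_coefficientsP.
Qed.

End face_to_face.

Section scaled_complexes.
Context {R : realType} {k : nat}.
Local Notation E := 'rV[R]_k.
Local Notation verts s := (@vertices R k s).
Implicit Types (s : {fset E}) (a : R).

Definition scale_simplex a s : {fset E} := [fset a *: w | w in s]%fset.

Definition scale_vertex a s (w : s) : scale_simplex a s :=
  [` in_imfset imfset_key (fun w => a *: w) (fsvalP w)]%fset.

Lemma scale_vertexE a s (w : s) :
  vertices (scale_vertex a w) = a *: vertices w.
Proof. by []. Qed.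

Lemma scale_simplexP a s (z : scale_simplex a s) :
  exists w, z = scale_vertex a w.
Proof.
have /imfsetP[/= w ws zE] := fsvalP z; exists [` ws]%fset.
by apply: val_inj; rewrite /= zE.
Qed.

Lemma scale_vertex_bij a s : a != 0 -> bijective (@scale_vertex a s).
Proof.
move=> a0; have inj_scale : injective (@scale_vertex a s).
  by move=> w w' /(congr1 val) /= /(scalerI a0)/val_inj.
apply: inj_card_bij inj_scale _.
have /choice[f fP] := @scale_simplexP a s.
by apply: (@leq_card _ _ f) => z z' zz'; rewrite (fP z) zz' -fP.
Qed.

Lemma scale_simplex_sub a s s' : a != 0 ->
  (scale_simplex a s `<=` scale_simplex a s')%fset = (s `<=` s')%fset.
Proof.
move=> a0; apply/fsubsetP/fsubsetP => ss' w.
  move=> ws; have /ss' : a *: w \in scale_simplex a s by exact: in_imfset.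
  by move=> /imfsetP[/= w' w's /(scalerI a0) ->].
by move=> /imfsetP[/= w' w's ->]; apply: in_imfset; exact: ss'.
Qed.

Variable C : set {fset E}.

Lemma scale_complexP a s :
  scale_complex a C s <-> exists2 s0, C s0 & s = scale_simplex a s0.
Proof. by split=> [[s0 Cs0 <-]|[s0 Cs0 ->]]; exists s0. Qed.

Lemma maximal_scale_complex a s : a != 0 ->
  maximal_simplex (scale_complex a C) s <->
  exists2 s0, maximal_simplex C s0 & s = scale_simplex a s0.
Proof.
move=> a0; split=> [[/scale_complexP[s0 Cs0 ->] smax]|[s0 [Cs0 smax] ->]].
  exists s0 => //; split=> // s1 Cs1 s01; apply/eqP.
  have /smax : scale_complex a C (scale_simplex a s1).
    by apply/scale_complexP; exists s1.
  rewrite scale_simplex_sub // => /(_ s01)/eqP.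
  by rewrite !eqEfsubset !scale_simplex_sub.
split=> [|_ /scale_complexP[s1 Cs1 ->]].
  by apply/scale_complexP; exists s0.
by rewrite scale_simplex_sub // => /(smax _ Cs1) ->.
Qed.

Hypothesis C_complex : simplicial_complex C.

Lemma scale_complex_finite a : finite_set (scale_complex a C).
Proof. exact/finite_image/(complex_finite C_complex). Qed.

Lemma scale_complex_nonempty a s : scale_complex a C s -> s != fset0.
Proof.
move=> /scale_complexP[s0 Cs0 ->].
have /fset0Pn[w ws] := complex_nonempty C_complex Cs0.
by apply/fset0Pn; exists (a *: w); exact: in_imfset.
Qed.

Lemma scale_complex_affine a s : scale_complex a C s ->
  affinely_independent (verts s).
Proof.
move=> /scale_complexP[s0 Cs0 ->]; have [->|a0] := eqVneq a 0.
  have vertex_unique (z z' : scale_simplex 0 s0) : z = z'.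
    have [[w ->] [w' ->]] := (scale_simplexP z, scale_simplexP z').
    by apply: val_inj; rewrite /= !scale0r.
  move=> b b1 _ t; apply: etrans b1; rewrite (big_only1 t) // => t'.
  by rewrite (vertex_unique t' t) eqxx.
apply: (affinely_independent_bij (scale_vertex_bij s0 a0)) => b b1 b0.
apply: (complex_affine C_complex Cs0 b1); apply: (scalerI a0); rewrite scaler0.
apply: etrans b0; rewrite scaler_sumr; apply: eq_bigr => t _.
by rewrite /= scale_vertexE !scalerA mulrC.
Qed.

Section ratio.
Variables (r d j : nat).
Hypothesis jd : (j <= d)%N.

Let a : R := j%:R / d%:R.

Let a_neq0 : (0 < j)%N -> a != 0.
Proof.
move=> j0; rewrite mulf_neq0 ?invr_eq0 ?pnatr_eq0 -?lt0n //.
exact: leq_trans jd.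
Qed.

Let mulVa : (0 < j)%N -> j%:R^-1 * a = d%:R^-1.
Proof. by move=> j0; rewrite mulKf // pnatr_eq0 -lt0n. Qed.

Lemma domain_points_scale_complex :
  domain_points (scale_complex a C) j =
  \bigcup_(s in C) lattice_points j d%:R^-1 (verts s).
Proof.
rewrite domain_pointsE bigcup_image; apply: eq_bigcupr => s Cs.
have [j0|j0] := posnP j; first by rewrite j0 !lattice_points0.
rewrite (lattice_points_bij _ _ _ (scale_vertex_bij s (a_neq0 j0))).
rewrite /lattice_points -mulVa //; apply: eq_imagel => l _.
exact: lattice_point_scale.
Qed.

Lemma coefficient_space_scale_complex :
  coefficient_space (scale_complex a C) r j = form_space C r j d%:R^-1.
Proof.
have [j0|j0] := posnP j.
  rewrite j0; apply/seteqP; split=> c _; exact: form_space_deg0.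
have scaled_form s g c :
    has_bform j (verts (scale_simplex a s))
      (c \o lattice_point j%:R^-1 (verts _)) g <->
    has_bform j (verts s) (c \o lattice_point d%:R^-1 (verts s))
      (fun x => g (a *: x)).
  have bij_scale := scale_vertex_bij s (a_neq0 j0).
  rewrite (has_bform_bij _ _ _ _ bij_scale) -has_bform_scale.
  rewrite (_ : (fun l => _) = c \o lattice_point d%:R^-1 (verts s)) //.
  apply/funext => l /=; rewrite lattice_point_extend; last exact: bij_inj.
  by rewrite -mulVa // -lattice_point_scale.
have Cr_scale b (g : E -> R) :
    Cr_function r g -> Cr_function r (fun x => g (b *: x)).
  by move=> /(Cr_scale_translate b 0); under eq_fun do rewrite addr0.
apply/seteqP; split=> c [g Cg gc].
  exists (fun x => g (a *: x)); first exact: Cr_scale.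
  move=> s ms; apply/scaled_form/gc.
  by apply/maximal_scale_complex; [exact: a_neq0|exists s].
exists (fun x => g (a^-1 *: x)); first exact: Cr_scale.
move=> s' /(maximal_scale_complex _ (a_neq0 j0))[s ms ->]; apply/scaled_form.
by under eq_fun do rewrite scalerA mulVf ?a_neq0 // scale1r; exact: gc.
Qed.

Lemma minimal_determining_set_scale_complex M :
  minimal_determining_set j (spline_space (scale_complex a C) r j) M <->
  minimally_determines (\bigcup_(s in C) lattice_points j d%:R^-1 (verts s))
    (form_space C r j d%:R^-1) M.
Proof.
rewrite -domain_points_scale_complex -coefficient_space_scale_complex.
apply: minimal_determining_setP => [|s [Cs _]|s [Cs _]].
- exact: scale_complex_finite.
- exact: scale_complex_nonempty Cs.
- exact: scale_complex_affine Cs.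
Qed.

End ratio.

End scaled_complexes.

(** * The join of a star with a simplex *)

Section diagonal_maps.
Context {R : realType} {k : nat}.
Implicit Types (e x : 'rV[R]_k).

Definition diag_map e x : 'rV[R]_k := x *m diag_mx e.

Lemma diag_map_is_linear e : linear (diag_map e).
Proof. by move=> a x y; rewrite /diag_map mulmxDl scalemxAl. Qed.

HB.instance Definition _ e :=
  GRing.isLinear.Build R 'rV[R]_k 'rV[R]_k *:%R (diag_map e)
    (diag_map_is_linear e).

Lemma diag_mapE e x u : diag_map e x 0 u = x 0 u * e 0 u.
Proof. by rewrite /diag_map mul_mx_diag mxE. Qed.

Definition tail_indicator (i : nat) : 'rV[R]_k := \row_u (i <= u)%N%:R.

Lemma tail_proj_eq0 i x : (forall u : 'I_k, (i <= u)%N -> x 0 u = 0) ->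
  diag_map (tail_indicator i) x = 0.
Proof.
move=> x0; apply/rowP => u; rewrite diag_mapE !mxE.
by case: leqP => iu; [rewrite x0 // mul0r|rewrite mulr0].
Qed.

Lemma tail_proj_id i x : (forall u : 'I_k, (u < i)%N -> x 0 u = 0) ->
  diag_map (tail_indicator i) x = x.
Proof.
move=> x0; apply/rowP => u; rewrite diag_mapE mxE.
by case: leqP => ui; [rewrite mulr1|rewrite x0 // mul0r].
Qed.

End diagonal_maps.

Section join.
Context {R : realType} {k : nat} {K : finType}.
Local Notation E := 'rV[R]_k.
Local Notation verts s := (@vertices R k s).
Implicit Types (s : {fset E}) (g c : E -> R).
Variables (r d : nat) (C : set {fset E}) (v : K -> E) (e : E).
Hypothesis C_complex : simplicial_complex C.
Hypothesis C_star : forall s, maximal_simplex C s -> 0 \in s.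
Hypothesis free_v : linearly_independent v.
(* In the theorem, diag_map e is the projection onto the last coordinates. *)
Hypothesis C_proj : forall s, C s -> forall w, w \in s -> diag_map e w = 0.
Hypothesis v_proj : forall t, diag_map e (v t) = v t.

Local Notation proj := (diag_map e).

Lemma proj_simplex s (b : s -> R) : C s -> proj (lincomb b (verts s)) = 0.
Proof.
move=> Cs; rewrite linear_lincomb /lincomb big1 // => w _ /=.
by rewrite (C_proj Cs (fsvalP w)) scaler0.
Qed.

Lemma proj_span (y : K -> R) : proj (lincomb y v) = lincomb y v.
Proof.
by rewrite linear_lincomb; congr lincomb; apply/funext => t; exact: v_proj.
Qed.

Let V : {fset E} := [fset v t | t in K]%fset.
Let O' := join_complex C V.

Lemma apex_in_V t : v t \in V.
Proof. exact: in_imfset. Qed.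

Lemma simplex_notin_V s w : C s -> w \in s -> w \notin V.
Proof.
move=> Cs ws; apply/negP => /imfsetP[/= t _ wE].
have := C_proj Cs ws; rewrite wE v_proj => /eqP.
by rewrite (negPf (linearly_independent_neq0 free_v t)).
Qed.

Lemma join_simplex s : maximal_simplex C s -> O' (s `|` V)%fset.
Proof.
move=> ms; split; last by exists s.
by apply/fset0Pn; exists 0; rewrite in_fsetU C_star.
Qed.

Lemma maximal_join s' : maximal_simplex O' s' <->
  exists2 s, maximal_simplex C s & s' = (s `|` V)%fset.
Proof.
split=> [[[_ [s ms s's]] s'max]|[s ms ->]].
  by exists s => //; apply/esym/s'max => //; exact: join_simplex.
split=> [|s1 [_ [s2 ms2 s12]] sV1]; first exact: join_simplex.
have ss2 : (s `<=` s2)%fset.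
  apply/fsubsetP => w ws; have /(fsubsetP s12) : w \in s1.
    by apply: (fsubsetP sV1); rewrite in_fsetU ws.
  by rewrite in_fsetU (negPf (simplex_notin_V (proj1 ms) ws)) orbF.
have s2E : s2 = s by apply: (proj2 ms) => //; exact: (proj1 ms2).
by apply/eqP; rewrite eqEfsubset sV1 -s2E s12.
Qed.

Lemma join_complex_finite : finite_set O'.
Proof.
have : finite_set (\bigcup_(s in C) [set` fpowerset (s `|` V)%fset]).
  apply: bigcup_finite => [|s _]; first exact: complex_finite C_complex.
  exact: finite_fset.
apply: sub_finite_set => s [_ [w [Cw _] sw]].
by exists w; rewrite //= fpowersetE.
Qed.

Definition join_vertex s (x : s + K) : (s `|` V)%fset :=
  match x with
  | inl w => fincl (fsubsetUl s V) w
  | inr t => fincl (fsubsetUr s V) [` apex_in_V t]%fset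
  end.

Definition join_vertices s : s + K -> E := case_sum (verts s) v.

Lemma join_vertexE s :
  verts (s `|` V)%fset \o @join_vertex s = @join_vertices s.
Proof. by apply/funext => -[]. Qed.

Lemma join_vertices_inj s : C s -> injective (@join_vertices s).
Proof.
move=> Cs [w|t] [w'|t'] /= ww'.
- by congr inl; exact: val_inj.
- by have := simplex_notin_V Cs (fsvalP w); rewrite [fsval w]ww' apex_in_V.
- by have := simplex_notin_V Cs (fsvalP w'); rewrite -[fsval w']ww' apex_in_V.
- by congr inr; exact: (linearly_independent_inj free_v).
Qed.

Lemma join_vertex_bij s : C s -> bijective (@join_vertex s).
Proof.
move=> Cs; have inj_join : injective (@join_vertex s).
  apply: (@inj_compr _ _ _ (verts _)); rewrite join_vertexE.
  exact: join_vertices_inj.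
have /choice[f fK] (z : (s `|` V)%fset) : exists x, join_vertex x = z.
  have := fsvalP z; rewrite in_fsetU => /orP[zs|/imfsetP[/= t _ zt]].
    by exists (inl [` zs]%fset); exact: val_inj.
  by exists (inr t); apply: val_inj; rewrite /= zt.
by exists f => // x; apply: inj_join; rewrite fK.
Qed.

Lemma proj_join s (b : s + K -> R) : C s ->
  proj (lincomb b (@join_vertices s)) = lincomb (b \o inr) v.
Proof.
move=> Cs.
by rewrite lincomb_case_sum linearD /= proj_simplex // add0r proj_span.
Qed.

Lemma join_coordinates_inj s s' (b : s + K -> R) (b' : s' + K -> R) :
  C s -> C s' ->
  lincomb b (@join_vertices s) = lincomb b' (@join_vertices s') ->
  b \o inr =1 b' \o inr /\
  lincomb (b \o inl) (verts s) = lincomb (b' \o inl) (verts s').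
Proof.
move=> Cs Cs' bb'; have apexE : lincomb (b \o inr) v = lincomb (b' \o inr) v.
  by rewrite -!proj_join // bb'.
split; first exact: lincomb_inj apexE.
by move: bb'; rewrite !lincomb_case_sum apexE => /addIr.
Qed.

Lemma join_complex_affine s : maximal_simplex O' s ->
  affinely_independent (verts s).
Proof.
move=> /maximal_join[s0 [Cs0 _] ->].
apply: (affinely_independent_bij (join_vertex_bij Cs0)).
rewrite join_vertexE => b b1 b0.
have [br bl] : b \o inr =1 (fun=> 0) \o inr /\ _ :=
  join_coordinates_inj Cs0 Cs0 (etrans b0 (esym (lincomb0 _))).
have b_apex t : b (inr t) = 0 by exact: br.
case=> // w; apply: (complex_affine C_complex Cs0 (b := b \o inl)).
  by apply: etrans b1; rewrite big_sumType /= [X in _ + X]big1 ?addr0.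
by apply: etrans bl _; exact: lincomb0.
Qed.

Lemma join_face_to_face : face_to_face O'.
Proof.
move=> _ _ /maximal_join[s ms ->] /maximal_join[s' ms' ->] b b' wb wb'.
have [Cs Cs'] := (proj1 ms, proj1 ms').
have [bij_s bij_s'] := (join_vertex_bij Cs, join_vertex_bij Cs').
have [inj_s inj_s'] := (join_vertices_inj Cs, join_vertices_inj Cs').
rewrite (lincomb_bij _ _ bij_s) (lincomb_bij _ _ bij_s') !join_vertexE => bb'.
have [apexE baseE] := join_coordinates_inj Cs Cs' bb'.
have mass_base s1 (b1 : (s1 `|` V)%fset -> R) : C s1 -> is_weight b1 ->
    \sum_w b1 (join_vertex (inl w)) = 1 - \sum_t b1 (join_vertex (inr t)).
  move=> Cs1 [_ <-]; rewrite (reindex (@join_vertex s1)) ?big_sumType ?addrK //.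
  exact/onW_bij/join_vertex_bij.
rewrite (extend_bij _ _ bij_s val_inj) (extend_bij _ _ bij_s' val_inj).
rewrite !join_vertexE !extend_case_sum //; apply/funext => z; case: ifP => _.
  by congr (extend _ _ _ z); exact/funext.
congr (_ z).
apply: (face_to_face_cone (complex_face_to_face C_complex) ms ms') => //.
- by move=> w; exact: (proj1 wb).
- by move=> w; exact: (proj1 wb').
- by rewrite !mass_base //; congr (1 - _); apply: eq_bigr => t _; exact: apexE.
Qed.

Lemma piecewise_bform_join n q g c : piecewise_bform O' n q g c <->
  forall s, maximal_simplex C s ->
    has_bform n (@join_vertices s) (c \o lattice_point q (@join_vertices s)) g.
Proof.
have join_form s : C s ->
    has_bform n (verts (s `|` V)%fset) (c \o lattice_point q (verts _)) g <->
    has_bform n (@join_vertices s) (c \o lattice_point q (@join_vertices s)) g.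
  move=> Cs; have bijs := join_vertex_bij Cs.
  rewrite (has_bform_bij _ _ _ _ bijs) join_vertexE.
  rewrite (_ : (fun l => _) = c \o lattice_point q (@join_vertices s)) //.
  apply/funext => l /=; rewrite lattice_point_extend ?join_vertexE //.
  exact: bij_inj.
split=> [gc s ms|gc _ /maximal_join[s ms ->]]; apply/(join_form _ (proj1 ms)).
  by apply: gc; apply/maximal_join; exists s.
exact: gc.
Qed.

Definition apex_point (j : {ffun K -> 'I_d.+1}) : E :=
  lattice_point d%:R^-1 v (entries j).

Lemma form_space_restrict c (j0 : {ffun K -> 'I_d.+1}) : (\sum_t j0 t <= d)%N ->
  coefficient_space O' r d c ->
  form_space C r (d - \sum_t j0 t) d%:R^-1 (fun p => c (p + apex_point j0)).
Proof.
move=> j0d [g Cg /piecewise_bform_join gc].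
have [lam lamP] := bform_case_sum_extract R j0d.
pose mass (y : {ffun K -> 'I_d.+1}) : R := 1 + \sum_t (y t).+1%:R.
have mass0 y : 0 < mass y by rewrite ltr_pwDl // sumr_ge0.
pose offset (y : {ffun K -> 'I_d.+1}) : E := lincomb (fun t => (y t).+1%:R) v.
exists (fun x => \sum_y lam y * (mass y ^+ d *
    g ((mass y)^-1 *: x + (mass y)^-1 *: offset y))).
  by apply: Cr_sum => y; do 2 apply: CrZ; exact: Cr_scale_translate.
move=> s ms b [b0 b1].
transitivity (bform (d - \sum_t j0 t) b
  (fun l => c (lattice_point d%:R^-1 (@join_vertices s)
     (case_sum l (entries j0))))).
  rewrite -(lamP _ b (c \o lattice_point d%:R^-1 (@join_vertices s))).
  apply: eq_bigr => y _; congr (_ * _).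
  have massE : mass y = \sum_x case_sum b (fun t => (y t).+1%:R) x.
    by rewrite big_sumType /= b1.
  rewrite (has_bform_cone (gc s ms)) -?massE //; last by case.
  by rewrite lincomb_case_sum scalerDr.
by apply: eq_bform => l _; rewrite lattice_point_case_sum.
Qed.

Definition extend_from (j0 : {ffun K -> 'I_d.+1}) c (z : E) : R :=
  if proj z == apex_point j0 then c (z - apex_point j0) else 0.

Lemma extend_fromE j0 c j p : proj p = 0 ->
  extend_from j0 c (p + apex_point j) = if j == j0 then c p else 0.
Proof.
move=> p0; rewrite /extend_from linearD /= p0 add0r proj_span.
case: (j =P j0) => [->|jj0]; first by rewrite eqxx addrK.
by case: eqP => // /(lattice_point_inj free_v).
Qed.

Lemma bform_extend_from s (b : s + K -> R) (j0 : {ffun K -> 'I_d.+1}) c :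
  C s -> (\sum_t j0 t <= d)%N ->
  bform d b (extend_from j0 c \o lattice_point d%:R^-1 (@join_vertices s)) =
  'C(d, \sum_t j0 t)%:R * bmonomial (\sum_t j0 t) (entries j0) (b \o inr) *
    bform (d - \sum_t j0 t) (b \o inl) (c \o lattice_point d%:R^-1 (verts s)).
Proof.
move=> Cs j0d; have coeffE l j :
    extend_from j0 c
      (lattice_point d%:R^-1 (@join_vertices s) (case_sum l (entries j))) =
    if j == j0 then c (lattice_point d%:R^-1 (verts s) l) else 0.
  by rewrite lattice_point_case_sum extend_fromE ?proj_simplex.
rewrite bform_case_sum (big_only1 j0) // => [|j /negPf jj0 _].
  by congr (_ * _); apply: eq_bform => l _; rewrite /= coeffE eqxx.
rewrite [bform _ _ _](_ : _ = 0) ?mulr0 //.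
rewrite -(linear0 (bform (d - \sum_t j t) (b \o inl))).
by apply: eq_bform => l _; rewrite /= coeffE jj0.
Qed.

Lemma apex_coordinates : exists y : K -> E -> R,
  (forall t, Cr_function r (y t)) /\
  forall s (b : s + K -> R), C s -> forall t,
    y t (lincomb b (@join_vertices s)) = b (inr t).
Proof.
have [beta betaE] := linearly_independent_coordinates free_v.
exists (fun t z => \sum_u beta t u * proj z 0 u); split=> [t|s b Cs t].
  under eq_fun do under eq_bigr do rewrite diag_mapE mulrCA mulrC.
  exact: Cr_linear_form.
by rewrite proj_join // betaE.
Qed.

Lemma form_space_extend c (j0 : {ffun K -> 'I_d.+1}) : (\sum_t j0 t <= d)%N ->
  form_space C r (d - \sum_t j0 t) d%:R^-1 c ->
  coefficient_space O' r d (extend_from j0 c).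
Proof.
set n := (d - _)%N => j0d [g Cg gc]; have [y [Cy yE]] := apex_coordinates.
pose base_mass z := 1 - \sum_t y t z.
have C_base_mass : Cr_function r base_mass.
  rewrite /base_mass; under eq_fun do rewrite -mulN1r.
  by apply: CrD; [exact: Cr_cst|apply/CrZ/Cr_sum].
pose star_form z := \sum_(i < n.+1) (node_poly i).[base_mass z] *
  (i.+1%:R ^+ n * g (i.+1%:R^-1 *: (z - proj z))).
exists (fun z => 'C(d, \sum_t j0 t)%:R *
    bmonomial (\sum_t j0 t) (entries j0) (y^~ z) * star_form z).
  apply: CrM.
    by do 2 apply: CrZ; apply: Cr_prod => t; exact: CrX.
  apply: Cr_sum => i; apply: CrM; first exact: Cr_horner.
  apply: CrZ; have := Cr_diag_affine (i.+1%:R^-1 *: (const_mx 1 - e)) 0 Cg.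
  under eq_fun do rewrite linearZ linearB /= diag_const_mx -scalemxAr.
  by under eq_fun do rewrite mulmxBr mulmx1 addr0.
apply/piecewise_bform_join => s ms b [b0 b1]; have Cs := proj1 ms.
have base_massE :
    base_mass (lincomb b (@join_vertices s)) = \sum_w (b \o inl) w.
  rewrite /base_mass; under eq_bigr do rewrite yE //.
  by rewrite -b1 big_sumType /= addrK.
rewrite bform_extend_from //; congr (_ * _ * _).
  by congr bmonomial; apply/funext => t; exact: yE.
have zero_vertex : vertices [` C_star ms]%fset = 0 :> E by [].
rewrite (star_bform_interpolation zero_vertex (gc s ms)).
- apply: eq_bigr => i _.
  by rewrite base_massE proj_join // lincomb_case_sum addrK.
- by move=> w; exact: b0.
- by rewrite -b1 big_sumType lerDl; apply: sumr_ge0.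
Qed.

Definition join_index := {j : {ffun K -> 'I_d.+1} | (\sum_t j t <= d)%N}.

Definition base_degree (j : join_index) : nat := d - \sum_t val j t.

Definition translate (j : join_index) (p : E) : E := p + apex_point (val j).

Let base_points (j : join_index) : set E :=
  \bigcup_(s in C) lattice_points (base_degree j) d%:R^-1 (verts s).

Lemma proj_base_points j p : base_points j p -> proj p = 0.
Proof. by move=> [s Cs [l _ <-]]; exact: proj_simplex. Qed.

Lemma translate_inj j j' p p' : base_points j p -> base_points j' p' ->
  translate j p = translate j' p' -> j = j' /\ p = p'.
Proof.
move=> /proj_base_points p0 /proj_base_points p'0 pp'.
have jj' : j = j'.
  apply/val_inj/(lattice_point_inj free_v); move/(congr1 proj): pp'.
  by rewrite !linearD /= p0 p'0 !add0r !proj_span.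
by split=> //; move: pp'; rewrite jj' => /addIr.
Qed.

Lemma domain_points_join : domain_points O' d = glue translate base_points.
Proof.
have finC := complex_finite C_complex.
rewrite domain_pointsE (lattice_points_maximal _ _ join_complex_finite).
apply/seteqP; split=> [p [_ /maximal_join[s ms ->]]|_ [j _ [p Dp <-]]].
  rewrite (lattice_points_bij _ _ _ (join_vertex_bij (proj1 ms))) join_vertexE.
  move=> /lattice_points_case_sum[j jd [p0 sp0 ->]].
  by exists (exist _ j jd) => //; exists p0 => //; exists s; [case: ms|].
move: Dp; rewrite /base_points lattice_points_maximal // => -[s ms sp].
exists (s `|` V)%fset; first by apply/maximal_join; exists s.
rewrite (lattice_points_bij _ _ _ (join_vertex_bij (proj1 ms))) join_vertexE.
by apply/lattice_points_case_sum; exists (val j); [exact: (valP j)|exists p].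
Qed.

Section minimal_sets.
Variable M : nat -> set E.
Hypothesis M_min : forall j, (j <= d)%N -> minimal_determining_set j
  (spline_space (scale_complex (j%:R / d%:R) C) r j) (M j).

Let base_set (j : join_index) : set E := M (base_degree j).

Let base_set_minimal j : minimally_determines (base_points j)
  (form_space C r (base_degree j) d%:R^-1) (base_set j).
Proof.
have jd : (base_degree j <= d)%N := leq_subr _ d.
exact/(minimal_determining_set_scale_complex C_complex r jd)/M_min.
Qed.

Let base_points_finite j : finite_set (base_points j).
Proof.
apply: bigcup_finite => [|s _]; first exact: complex_finite C_complex.
exact: lattice_points_finite.
Qed.

Lemma join_minimal_determining_set :
  minimal_determining_set d (spline_space O' r d) (glue translate base_set).
Proof.
have ne_join s : maximal_simplex O' s -> s != fset0 by move=> [[]].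
apply/(minimal_determining_setP _ _ join_complex_finite ne_join
  join_complex_affine).
rewrite domain_points_join; apply: (glue_minimally_determines
  base_points_finite _ _ _ _ base_set_minimal) => [j||j c|j c].
- exact: form_space_subspace.
- exact: form_space_subspace.
- exact: form_space_restrict (valP j).
- move=> Wc; exists (extend_from (val j) c).
    exact: form_space_extend (valP j) Wc.
  by move=> j' p /proj_base_points p0; rewrite extend_fromE.
Qed.

Lemma join_spline_space_dim : has_dim (spline_space O' r d)
  (\sum_(j : join_index) #|` fset_set (base_set j)|)%N.
Proof.
have base_sub j : base_set j `<=` base_points j.
  by have [[]] := base_set_minimal j.
rewrite -(card_glue (phi := translate)) => [|j j' p p' Mp Mp'|j]; last 2 first.
- exact: translate_inj (base_sub j p Mp) (base_sub j' p' Mp').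
- exact: sub_finite_set (base_sub j) (base_points_finite j).
apply: spline_space_dim join_minimal_determining_set.
- exact: join_complex_finite.
- by move=> s [[]].
- exact: join_complex_affine.
- move=> f; apply: spline_coefficients_exist; first exact: join_face_to_face.
  by move=> _ /maximal_join[s ms ->]; rewrite in_fsetU C_star.
Qed.

End minimal_sets.

End join.

Lemma card_multi_index (m d n : nat) : (n <= d)%N ->
  #|[set l : {ffun 'I_m.+1 -> 'I_d.+1} | (\sum_t l t)%N == n]%SET| =
  'C(m + n, m).
Proof.
move=> nd; rewrite -card_ord_partitions.
pose of_tuple (t : m.+1.-tuple 'I_n.+1) : {ffun 'I_m.+1 -> 'I_d.+1} :=
  of_entries d (fun u => tnth t u).
have of_tupleE t u : of_tuple t u = tnth t u :> nat.
  rewrite -[LHS]/(entries (of_tuple t) u) of_entriesK // => w.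
  by rewrite (leq_trans _ nd) // -ltnS.
have inj_of_tuple : injective of_tuple.
  move=> t t' tt'; apply: eq_from_tnth => u; apply: val_inj.
  by rewrite /= -!of_tupleE tt'.
rewrite -(card_imset _ inj_of_tuple); apply: eq_card => l; rewrite inE.
apply/eqP/imsetP => [ln|[t]]; last first.
  rewrite inE big_tuple => /eqP <- ->; apply: eq_bigr => u _.
  exact: of_tupleE.
have entry_lt u : (l u < n.+1)%N.
  by rewrite ltnS -ln (leq_sum_entry (entries l)).
exists [tuple inord (l u) | u < m.+1]; last first.
  by apply/ffunP => u; apply: val_inj; rewrite /= of_tupleE tnth_mktuple inordK.
rewrite inE big_tuple -[X in _ == X]ln; apply/eqP/eq_bigr => u _.
by rewrite tnth_mktuple inordK.
Qed.

Lemma card_multi_index_binz (i k d j : nat) : (i <= k)%N -> (j <= d)%N ->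
  #|[set l : {ffun 'I_(k - i) -> 'I_d.+1} | (\sum_t l t)%N == (d - j)%N]%SET| =
  binz (d%:Z + k%:Z - j%:Z - i%:Z - 1) (k%:Z - i%:Z - 1).
Proof.
move=> ik jd.
have -> : d%:Z + k%:Z - j%:Z - i%:Z - 1 = (d - j)%N%:Z + (k - i)%N%:Z - 1.
  by rewrite -!subzn //; ring.
rewrite subzn //; case: (k - i)%N => [|m]; last first.
  rewrite card_multi_index ?leq_subr //.
  by rewrite -addn1 !PoszD !addrA !addrK -PoszD addnC.
rewrite addr0 sub0r -sum1_card; under eq_bigl do rewrite inE big_ord0.
case: (d - j)%N => [|n]; last by rewrite big_pred0.
by rewrite sum1_card -[#|_|]/#|{: {ffun 'I_0 -> 'I_d.+1}}| card_ffun !card_ord.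
Qed.

Lemma sum_join_index (K : finType) d (F : nat -> nat) :
  (\sum_(j : join_index (K := K) d) F (base_degree j) =
   \sum_(0 <= j < d.+1)
     #|[set l : {ffun K -> 'I_d.+1} | (\sum_t l t)%N == (d - j)%N]%SET| *
     F j)%N.
Proof.
transitivity (\sum_(l : {ffun K -> 'I_d.+1} | (\sum_t l t <= d)%N)
    F (d - \sum_t l t))%N.
  rewrite [RHS](reindex_omap (fun x : join_index d => val x) insub) /=.
    by apply: eq_bigl => x; rewrite valK eqxx andbT (valP x).
  by move=> l ld; rewrite insubT.
pose degree (l : {ffun K -> 'I_d.+1}) : 'I_d.+1 := inord (d - \sum_t l t).
rewrite (partition_big degree xpredT) //= big_mkord.
apply: eq_bigr => j _; rewrite -sum1_card big_distrl /=.
apply: eq_big => l; last first.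
  by move=> /andP[ld /eqP <-]; rewrite mul1n inordK // ltnS leq_subr.
rewrite inE -val_eqE /= inordK ?ltnS ?leq_subr //.
apply/andP/eqP => [[ld /eqP <-]|ld]; first by rewrite subKn.
have jd : (j <= d)%N by rewrite -ltnS.
by rewrite ld leq_subr subKn.
Qed.

Section simplex_at_origin.
Context {R : realType} {k m d : nat}.
Variable v : 'I_m.+1 -> 'rV[R]_k.
Hypothesis v0 : v ord0 = 0.

Local Notation apexes := (fun t => v (lift ord0 t)).

Lemma affinely_independent_lift0 :
  affinely_independent v -> linearly_independent apexes.
Proof.
move=> affv y y0 t.
pose b u := if unlift ord0 u is Some t then y t else - \sum_t y t.
have b_lift u : b (lift ord0 u) = y u by rewrite /b liftK.
rewrite -b_lift; apply: affv; rewrite big_ord_recl.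
  by under eq_bigr do rewrite b_lift; rewrite /b unlift_none addNr.
rewrite v0 scaler0 add0r; apply: etrans y0.
by apply: eq_bigr => u _; rewrite b_lift.
Qed.

Lemma domain_point_lift0 (l : {ffun 'I_m.+1 -> 'I_d.+1}) :
  domain_point v l = apex_point apexes [ffun t => l (lift ord0 t)].
Proof.
rewrite domain_pointE /lattice_point /lincomb big_ord_recl v0 scaler0 add0r.
by apply: eq_bigr => t _; rewrite /entries ffunE.
Qed.

Lemma bigcup_domain_points_glue (M : nat -> set 'rV[R]_k) :
  \bigcup_(j < d.+1) [set p + domain_point v l | p in M j &
     l in [set l : {ffun 'I_m.+1 -> 'I_d.+1} |
            multi_index _ d l /\ l ord0 = j :> nat]] =
  glue (translate apexes) (fun j : join_index d => M (base_degree j)).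
Proof.
apply/seteqP; split=> [_ [j jd [p Mp [l [/eqP ld lj] <-]]]|_ [j _ [p Mp <-]]].
  pose jv : {ffun 'I_m -> 'I_d.+1} := [ffun t => l (lift ord0 t)].
  have jv_sum : (\sum_t jv t)%N = (d - j)%N.
    rewrite -[in RHS]ld -lj big_ord_recl addKn.
    by apply: eq_bigr => t _; rewrite ffunE.
  have jvd : (\sum_t jv t <= d)%N by rewrite jv_sum leq_subr.
  exists (exist _ jv jvd) => //; exists p; last by rewrite domain_point_lift0.
  by rewrite /base_degree /= jv_sum subKn.
exists (base_degree j); first by rewrite /= ltnS leq_subr.
exists p => //.
pose l : {ffun 'I_m.+1 -> 'I_d.+1} :=
  [ffun u => if unlift ord0 u is Some t then val j t
             else inord (base_degree j)].
have l_lift t : l (lift ord0 t) = val j t by rewrite ffunE liftK.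
have l0 : l ord0 = base_degree j :> nat.
  by rewrite ffunE unlift_none inordK // ltnS leq_subr.
exists l.
  split=> //; rewrite /multi_index big_ord_recl l0.
  under eq_bigr do rewrite l_lift.
  by rewrite subnK //; exact: (valP j).
rewrite domain_point_lift0 /translate; congr (_ + apex_point _ _).
by apply/ffunP => t; rewrite ffunE l_lift.
Qed.

End simplex_at_origin.

Theorem theorem5p2 (R : realType) (i k r d : nat)
  (C : set {fset 'rV[R]_k}) (v : 'I_(k - i).+1 -> 'rV[R]_k)
  (M : nat -> set 'rV[R]_k)
  (hik : (i <= k)%N) (hrd : (r <= d)%N)
  (C_complex : simplicial_complex C) (C_dim : complex_dim C i)
  (C_sub : polyhedron C `<=`
     [set x : 'rV[R]_k | forall t : 'I_k, (i <= t)%N -> x 0 t = 0])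
  (C_star : star_of_origin
              [set x : 'rV[R]_k | forall t : 'I_k, (i <= t)%N -> x 0 t = 0] C)
  (v0 : v ord0 = 0) (v_affine : affinely_independent v)
  (v_sub : conv_hull v `<=`
     [set x : 'rV[R]_k | forall t : 'I_k, (t < i)%N -> x 0 t = 0])
  (M_min : forall j : nat, (j <= d)%N ->
     minimal_determining_set j
       (spline_space (scale_complex (j%:R / d%:R) C) r j) (M j)) :
  let O' := join_complex C [fset v (lift ord0 t) | t in 'I_(k - i)]%fset in
  minimal_determining_set d (spline_space O' r d)
    (\bigcup_(j < d.+1)
       [set p + domain_point v l | p in M j &
          l in [set l : {ffun 'I_(k - i).+1 -> 'I_d.+1} |
                 multi_index _ d l /\ l ord0 = j :> nat]]) /\
  has_dim (spline_space O' r d)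
    (\sum_(0 <= j < d.+1)
       binz (d%:Z + k%:Z - j%:Z - i%:Z - 1) (k%:Z - i%:Z - 1)
         * #|` fset_set (M j)|)%N.
Proof.
move=> O'; pose apexes (t : 'I_(k - i)) := v (lift ord0 t).
have C_proj s : C s -> forall w, w \in s -> diag_map (tail_indicator i) w = 0.
  move=> Cs w ws; apply/tail_proj_eq0/C_sub; exists s => //.
  exact: (conv_hull_vertex (@vertices R k s) [` ws]%fset).
have apex_proj t : diag_map (tail_indicator i) (apexes t) = apexes t.
  exact/tail_proj_id/v_sub/conv_hull_vertex.
have free_apexes := affinely_independent_lift0 v0 v_affine.
have [C0 _] := C_star.
rewrite bigcup_domain_points_glue //; split.
  exact: (join_minimal_determining_set C_complex C0 free_apexes C_proj
    apex_proj M_min).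
have := join_spline_space_dim C_complex C0 free_apexes C_proj apex_proj M_min.
rewrite (sum_join_index _ d (fun j => #|` fset_set (M j)|)).
by congr has_dim; apply: eq_big_nat => j jd; rewrite card_multi_index_binz.
Qed.
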